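(* Let $\tau\in(\alpha,\beta)\mapsto A(\tau)\in\mathcal{M}^-$ be a continuous matrix function and let $S_A(s,t)$ be the solution operator (from time $s$ to time $t$) of $\dot x=A(t)x$. Let $\tilde n=n$ if $n$ is odd and $\tilde n=n-1$ if $n$ is even. Then, for any fixed $s,t\in(\alpha,\beta)$ with $s<t$, there exist subspaces $W_i$, $i\in\{1,\dots,\frac{\tilde n+1}{2}\}$, of $\mathbb{R}^n$, invariant under $S_A(s,t)$, such that $$\dim W_i=2,\quad i=1,\dots,\tfrac{\tilde n-1}{2},\qquad \dim W_{\frac{\tilde n+1}{2}}=\begin{cases}1 & \text{if } n=\tilde n \text{ is odd},\\ 2 & \text{if } n=\tilde n+1\text{ is even},\end{cases}$$ and $$\mathbb{R}^n=W_1\oplus W_2\oplus\cdots\oplus W_{\frac{\tilde n+1}{2}}.$$ If $x\in W_i\setminus\{0\}$, then $x\in\mathcal{N}$ and $N(x)=2i-1$, for $i=1,\dots,\frac{\tilde n+1}{2}$. If $x\in W_i\oplus W_{i+1}\oplus\cdots\oplus W_k$ and $x\neq0$, then $N_m(x)\ge 2i-1$ and $N_M(x)\le 2k-1$. Moreover, if $\nu_i$ and $\mu_i$ are the minimum and the maximum modulus of the eigenvalues of the restriction of $S_A(s,t)$ to $W_i$, then $$\mu_1\ge\nu_1>\mu_2\ge\nu_2>\cdots>\mu_{\frac{\tilde n+1}{2}}\ge\nu_{\frac{\tilde n+1}{2}}.$$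
   Context: Throughout, $n\ge 3$. $\mathcal{M}^-$ is the set of real $n\times n$ matrices $A=(a_{ij})$ whose only possibly nonzero entries are $a_{ii}=a_i$ ($1\le i\le n$), $a_{i,i+1}=b_i$, $a_{i+1,i}=c_i$ ($1\le i\le n-1$), $a_{n,1}=b_n$, $a_{1,n}=c_n$, such that $b_ic_i\ge 0$ for $i=1,\dots,n$, $\prod_{i=1}^n b_i+\prod_{i=1}^n c_i\neq 0$, and either ($b_i>0$ for $i=1,\dots,n-1$ and $b_n<0$) or ($c_i>0$ for $i=1,\dots,n-1$ and $c_n<0$). Integer-valued function: for $x\in\mathbb{R}^n$ with all coordinates nonzero, $N(x)=\operatorname{card}\{i\in\{1,\dots,n\}\mid \delta_i x_i x_{i+1}<0\}$, where $x_{n+1}=x_1$, $\delta_i=1$ for $1\le i\le n-1$ and $\delta_n=-1$; it takes only odd values. For any $x\in\mathbb{R}^n$, $N_m(x)$ and $N_M(x)$ are the minimum and maximum of $N(y)$ over all $y$ with all coordinates nonzero in a sufficiently small neighborhood of $x$. $\mathcal{N}=\{x\in\mathbb{R}^n\mid N_m(x)=N_M(x)\}$, and $N$ is extended to $\mathcal{N}$ by $N(x)=N_m(x)=N_M(x)$. *)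

(* Defs.v *)
From HB Require Import structures.
From mathcomp Require Import all_boot all_order all_algebra.
From mathcomp Require Import complex.
From mathcomp Require Import all_classical all_reals all_analysis.

Set Implicit Arguments.
Unset Strict Implicit.
Unset Printing Implicit Defensive.

Import Order.TTheory GRing.Theory Num.Theory.
Import numFieldNormedType.Exports.

Local Open Scope classical_set_scope.
Local Open Scope ring_scope.

(* Indices 1, ..., n are represented by 0, ..., n-1 : 'I_n, and i + 1 is the
   cyclic successor ordS i; the last index is the one with i.+1 = n. *)

Section CyclicMatrices.
Variables (R : realType) (n : nat).
Implicit Types A : 'M[R]_n.

Definition upper_entry A (i : 'I_n) : R := A i (ordS i).
Definition lower_entry A (i : 'I_n) : R := A (ordS i) i.

Definition negative_feedback (b : 'I_n -> R) : Prop :=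
  (forall i : 'I_n, (i.+1 < n)%N -> 0 < b i) /\
  (forall i : 'I_n, i.+1 = n -> b i < 0).

Definition Mminus : set 'M[R]_n := [set A : 'M[R]_n |
  [/\ forall i j, A i j != 0 -> [\/ j = i, j = ordS i | i = ordS j],
      forall i, 0 <= upper_entry A i * lower_entry A i,
      \prod_i upper_entry A i + \prod_i lower_entry A i != 0 &
      negative_feedback (upper_entry A) \/ negative_feedback (lower_entry A)]].

End CyclicMatrices.

Definition is_minimum d (T : porderType d) (X : set T) (m : T) : Prop :=
  X m /\ lbound X m.
Definition is_maximum d (T : porderType d) (X : set T) (m : T) : Prop :=
  X m /\ ubound X m.

Section SignChanges.
Variables (R : realType) (n : nat).
Implicit Types x y : 'cV[R]_n.

Definition nonvanishing x : Prop := forall i, x i 0 != 0.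

Definition delta (i : 'I_n) : R := if i.+1 == n then -1 else 1.

(* Only meaningful for nonvanishing x; see Next for the extension. *)
Definition Nsgn x : nat :=
  #|[set i : 'I_n | delta i * x i 0 * x (ordS i) 0 < 0]%SET|.

Definition Nvalues x (e : R) : set nat :=
  [set Nsgn y | y in [set y | ball x e y /\ nonvanishing y]].

(* The set Nvalues x e decreases with e and is nonempty and bounded by n, so it
   is constant for small e > 0 and get below picks its minimum (maximum). *)
Definition Nmin x : nat :=
  get [set k | \forall e \near 0^'+, is_minimum (Nvalues x e) k].
Definition Nmax x : nat :=
  get [set k | \forall e \near 0^'+, is_maximum (Nvalues x e) k].

Definition Ndomain : set 'cV[R]_n := [set x | Nmin x = Nmax x].

(* Extension of Nsgn to Ndomain, where Nmin and Nmax agree. *)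
Definition Next x : nat := Nmin x.

End SignChanges.

Section LinearODE.
Variables (R : realType) (n : nat) (alpha beta : \bar R).

Definition oitv : set R := [set u | (alpha < u%:E)%E /\ (u%:E < beta)%E].

Definition is_solution (A : R -> 'M[R]_n) (x : R -> 'cV[R]_n) : Prop :=
  forall u, oitv u -> is_derive u 1 x (A u *m x u).

(* S s t is the matrix of the solution operator from time s to time t; by
   uniqueness of solutions this determines S s t for s, t in the interval. *)
Definition is_solution_operator (A : R -> 'M[R]_n) (S : R -> R -> 'M[R]_n) :
    Prop :=
  forall s (v : 'cV[R]_n), oitv s ->
    S s s *m v = v /\ is_solution A (fun t => S s t *m v).

End LinearODE.

Section Spectrum.
Variables (R : realType) (n : nat).

Definition invariant_subspace (M : 'M[R]_n) (W : {vspace 'cV[R]_n}) : Prop :=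
  forall x, x \in W -> M *m x \in W.

(* z is a complex eigenvalue of the restriction of M to the invariant subspace
   W: the eigenvector lies in the complexification W + iW. *)
Definition restr_eigenvalue (M : 'M[R]_n) (W : {vspace 'cV[R]_n}) (z : R[i]) :
    Prop :=
  exists v : 'cV[R[i]]_n,
    [/\ v != 0, map_mx (@complex.Re R) v \in W, map_mx (@complex.Im R) v \in W &
        map_mx (real_complex R) M *m v = z *: v].

Definition restr_moduli (M : 'M[R]_n) (W : {vspace 'cV[R]_n}) : set R :=
  [set Normc.normc z | z in restr_eigenvalue M W].

End Spectrum.

Definition ntilde (n : nat) : nat := if odd n then n else n.-1.

Definition nblocks (n : nat) : nat := (ntilde n).+1./2.

(* Main.v *)
Require Import Defs.
From HB Require Import structures.
From mathcomp Require Import all_boot all_order all_algebra.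
From mathcomp Require Import complex.
From mathcomp Require Import all_classical all_reals all_analysis.
From mathcomp Require Import ring lra zify.

(* For a nontrivial solution x, Nmax (x t) <= Nmin (x s) whenever s < t.  The
   weak form Nmin (x t) <= Nmin (x s) holds because the closed cone Nmin <= c is
   flow invariant: by Nagumo's tangency criterion it is enough to treat each
   entry of A(u) separately, and adding to a coordinate a multiple of its
   neighbour with the twisted sign of the edge creates no sign change.  It
   becomes strict because every time interval contains a time at which x lies in
   Ndomain: otherwise, on a subinterval, every coordinate is identically zero or
   never zero, and the differential equation then forces each zero coordinate to
   have neighbours of opposite twisted signs.

   For M = S s t, let V_i consist of 0 and of the x such that
   Nmin (M ^ k x) >= 2i + 1 for all k >= 0.  Rescaled limits of orbits show that
   M ^ k x = o(M ^ k x') when x is in V_i and x' is not.  Hence V_i is a subspace,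
   and later the moduli of the eigenvalues are separated.  By compactness some
   M ^ k maps a complement of V_(i+1) in V_i into the set where Nmin and Nmax
   equal 2i + 1; such a subspace has dimension at most 2 (at most 1 if 2i + 1 = n),
   since Ndomain contains no vector with two consecutive zeros.  This bounds the
   dimension of V_i from below.  With the analogous subspaces U_i for the inverse
   of M and the bound Nmax <= 2i + 1, W_i is the intersection of V_i and U_i, and
   the dimension bounds are attained because they add up to n. *)

Set Implicit Arguments.
Unset Strict Implicit.
Unset Printing Implicit Defensive.

Import Order.TTheory GRing.Theory Num.Theory.
Import numFieldNormedType.Exports.

Local Open Scope classical_set_scope.
Local Open Scope ring_scope.

(** * Sign changes *)

Section SignCount.
Variables (R : realType) (n : nat).
Implicit Types (x y z : 'cV[R]_n) (i j k : 'I_n).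

(** The twisted product across the edge from [i] to [ordS i]; the sign changes are its negative
    values. *)
Definition edge y i : R := delta R i * y i 0 * y (ordS i) 0.

(** Since [Nsgn] depends only on signs, the nonvanishing points near [x] can be replaced by all
    choices of signs at the zeros of [x]. This removes the radius from [Nmin] and [Nmax]. *)
Definition completion x y : Prop :=
  nonvanishing y /\ forall i, x i 0 != 0 -> 0 < x i 0 * y i 0.

Definition flip y j : 'cV[R]_n :=
  \col_i (if i == j then - y i 0 else y i 0).

Lemma delta_neq0 i : delta R i != 0.
Proof. by rewrite /delta; case: ifP; rewrite ?oppr_eq0 oner_eq0. Qed.

Lemma NsgnE y : Nsgn y = (\sum_i (edge y i < 0)%R)%N.
Proof.
rewrite /Nsgn -sum1_card big_mkcond /=.
by apply: eq_bigr => i _; rewrite inE /edge; case: ifP.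
Qed.

Lemma pos_mulr_trans (a b c : R) : 0 < a * b -> 0 < b * c -> 0 < a * c.
Proof.
have [b0|b0|->] := ltgtP b 0; last by rewrite mulr0 ltxx.
  by rewrite nmulr_lgt0 // nmulr_rgt0 // => a0 c0; rewrite nmulr_rgt0.
by rewrite pmulr_lgt0 // pmulr_rgt0 // => a0 c0; rewrite mulr_gt0.
Qed.

Lemma edge_lt0_same y z i : 0 < y i 0 * z i 0 ->
  0 < y (ordS i) 0 * z (ordS i) 0 -> (edge y i < 0) = (edge z i < 0).
Proof.
move=> h1 h2; have h : 0 < edge y i * edge z i.
  rewrite /edge [X in 0 < X](_ : _ = (delta R i * delta R i) *
    ((y i 0 * z i 0) * (y (ordS i) 0 * z (ordS i) 0))); last by ring.
  by apply: mulr_gt0; [rewrite -expr2 exprn_even_gt0 //= delta_neq0|exact: mulr_gt0].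
have [yi|yi|yi] := ltgtP (edge y i) 0.
- by move: h; rewrite nmulr_rgt0 // => ->.
- by move: h; rewrite pmulr_rgt0 // => hz; apply/esym/negbTE; rewrite -leNgt ltW.
- by move: h; rewrite yi mul0r ltxx.
Qed.

Lemma Nsgn_same y z : (forall i, 0 < y i 0 * z i 0) -> Nsgn y = Nsgn z.
Proof.
by move=> h; rewrite !NsgnE; apply: eq_bigr => i _; rewrite (@edge_lt0_same y z).
Qed.

Lemma Nsgn_le y : (Nsgn y <= n)%N.
Proof. by rewrite /Nsgn -[X in (_ <= X)%N]card_ord max_card. Qed.

Lemma edge_neq0 y i : nonvanishing y -> edge y i != 0.
Proof. by move=> hy; rewrite /edge !mulf_neq0 ?delta_neq0. Qed.

Lemma flip_nonvanishing y j : nonvanishing y -> nonvanishing (flip y j).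
Proof. by move=> hy i; rewrite mxE; case: ifP; rewrite ?oppr_eq0 hy. Qed.

Lemma ordS_neq i : (1 < n)%N -> ordS i != i.
Proof.
move=> n1; apply/eqP => /(congr1 val) /= h; have := ltn_ord i.
rewrite leq_eqVlt => /predU1P [iS|iS].
  by move: h; rewrite iS modnn => i0; move: n1; rewrite -iS -i0.
by move: h; rewrite modn_small // => /eqP; rewrite eqn_leq ltnn.
Qed.

Lemma ord_pred_neq i : (1 < n)%N -> ord_pred i != i.
Proof.
by move=> n1; apply/eqP => h; have /eqP := ordS_neq (ord_pred i) n1;
   rewrite ord_predK h.
Qed.

Lemma ordSS_neq i : (2 < n)%N -> ordS (ordS i) != i.
Proof.
move=> n3; apply/negP => /eqP /(congr1 val) /=.
have := ltn_ord i; rewrite leq_eqVlt => /predU1P [jn|jn].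
  by rewrite jn modnn modn_small ?(ltnW n3) // => j1; move: n3; rewrite -jn -j1.
rewrite (modn_small jn); move: jn; rewrite leq_eqVlt => /predU1P [jn|jn].
  by rewrite jn modnn => j1; move: n3; rewrite -jn -j1.
by rewrite (modn_small jn) => /eqP; rewrite -[X in _ == X]addn0 -[X in X == _]addn2 eqn_add2l.
Qed.

Lemma NsgnD2 y j : (1 < n)%N -> Nsgn y =
  ((edge y j < 0)%R + (edge y (ord_pred j) < 0)%R +
   \sum_(i | (i != j) && (i != ord_pred j)) (edge y i < 0)%R)%N.
Proof.
move=> n1; rewrite NsgnE (bigD1 j) //= (bigD1 (ord_pred j)) /= ?addnA //.
exact: ord_pred_neq.
Qed.

(** Only the two edges at [j] are affected, and each reverses its sign. Both sides are sums, so that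
    no truncated subtraction occurs. *)
Lemma Nsgn_flip y j : (1 < n)%N -> nonvanishing y ->
  (Nsgn (flip y j) + ((edge y j < 0)%R + (edge y (ord_pred j) < 0)%R) =
   Nsgn y + ((0 < edge y j)%R + (0 < edge y (ord_pred j))%R))%N.
Proof.
move=> n1 ynz; rewrite !(NsgnD2 _ j n1).
have -> : edge (flip y j) j = - edge y j.
  by rewrite /edge !mxE eqxx (negbTE (ordS_neq _ _)) // mulrN mulNr.
have -> : edge (flip y j) (ord_pred j) = - edge y (ord_pred j).
  by rewrite /edge !mxE ord_predK eqxx (negbTE (ord_pred_neq _ _)) // mulrN.
rewrite !oppr_lt0 [X in (_ + _ + X + _)%N = _](_ : _ =
   \sum_(i | (i != j) && (i != ord_pred j)) (edge y i < 0)%R)%N; last first.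
  apply: eq_bigr => i /andP [ij ipj]; rewrite /edge !mxE (negbTE ij).
  by rewrite -[j]ord_predK (inj_eq (can_inj (@ordSK n))) (negbTE ipj).
by rewrite addnC addnA [RHS]addnAC.
Qed.

Lemma flip_completion x y j : completion x y -> x j 0 = 0 ->
  completion x (flip y j).
Proof.
move=> [ynz xy] xj; split; first exact: flip_nonvanishing.
move=> i xi; rewrite mxE; case: eqP => [ij|_]; last exact: xy.
by move: xi; rewrite ij xj eqxx.
Qed.

(** Each coordinate lies on two edges and the factors [delta] multiply to -1, so the product of all
    edges is minus a square. *)
Lemma odd_Nsgn y : (0 < n)%N -> nonvanishing y -> odd (Nsgn y).
Proof.
move=> n0 ynz.
have key (s : seq 'I_n) : (0 < (-1) ^+ (\sum_(i <- s) (edge y i < 0)%R)%N *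
    \prod_(i <- s) edge y i).
  elim: s => [|i s IH]; first by rewrite !big_nil mulr1.
  rewrite !big_cons exprD mulrACA mulr_gt0 //.
  have [h|h|h] := ltgtP (edge y i) 0; last by have := edge_neq0 i ynz; rewrite h eqxx.
    by rewrite expr1 mulN1r oppr_gt0.
  by rewrite expr0 mul1r.
have := key (index_enum 'I_n); rewrite -NsgnE -signr_odd.
have -> : \prod_i edge y i = - (\prod_i y i 0) ^+ 2.
  rewrite /edge !big_split /= expr2 -mulrA -[RHS]mulN1r; congr (_ * _); last first.
    congr (_ * _); rewrite [RHS](reindex_inj (can_inj (@ordSK n))) //.
  have n1n : (n.-1 < n)%N by rewrite prednK.
  rewrite (bigD1 (Ordinal n1n)) //= big1 /delta /=.
    by rewrite prednK // eqxx mulr1.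
  move=> i; rewrite -val_eqE /= => h; case: ifP => // /eqP hi.
  by case/eqP: h; exact: (congr1 predn hi).
case: (odd _) => //; rewrite expr0 mul1r oppr_gt0 ltNge sqr_ge0 //.
Qed.


(** * Extremal sign counts through completions *)

Lemma completion_exists x : exists y, completion x y.
Proof.
exists (\col_i (if x i 0 == 0 then 1 else x i 0)); split=> i; rewrite !mxE.
  by case: ifP => [_|->//]; rewrite oner_eq0.
by move=> xi; rewrite (negbTE xi) -expr2 exprn_even_gt0.
Qed.

Lemma mulr_gt0_dist (a b : R) : `|a - b| < `|a| -> 0 < a * b.
Proof.
have [a0|a0|->] := ltgtP a 0; last by rewrite normr0 ltNge normr_ge0.
  by rewrite (ltr0_norm a0) ltr_norml opprK nmulr_rgt0 // => /andP [? ?]; lra.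
by rewrite (gtr0_norm a0) ltr_norml pmulr_rgt0 // => /andP [? ?]; lra.
Qed.

(** Closer to [x] than its smallest nonzero modulus, no nonzero coordinate changes sign; conversely,
    any choice of signs at the zeros is realised within distance [e]. *)
Lemma completion_near x : exists2 d : R, 0 < d &
  forall e, 0 < e -> e < d ->
  Nvalues x e = [set Nsgn y | y in [set y | completion x y]].
Proof.
(* The initial value 1 keeps [d] positive when [x] has no nonzero coordinate. *)
pose d := \big[Num.min/1]_(i | x i 0 != 0) `|x i 0|.
have d0 : 0 < d.
  by apply/bigmin_gtP; split => // i; rewrite normr_gt0.
exists d => // e e0 ed; apply/seteqP; split=> k [y].
  move=> [xy ynz] <-; exists y => //; split=> // i xi.
  have /= [_ /(_ i 0)] := xy; rewrite -ball_normE /= => h.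
  apply: mulr_gt0_dist.
  by rewrite (lt_trans h) // (lt_le_trans ed) // /d bigmin_le_cond.
move=> [ynz xy] <-.
pose z : 'cV[R]_n := \col_i (if x i 0 == 0 then e / 2 * Num.sg (y i 0) else x i 0).
have zy i : 0 < z i 0 * y i 0.
  rewrite mxE; case: eqP => [_|/eqP xi]; last exact: xy.
  by rewrite -(mulrA (e / 2)) -normrEsg mulr_gt0 ?divr_gt0 // normr_gt0.
exists z; last exact: Nsgn_same.
split; last by move=> i; apply: contraTneq (zy i) => ->; rewrite mul0r ltxx.
split=> // i j; rewrite ord1 -ball_normE /= mxE; case: eqP => [->|_].
  rewrite sub0r normrN normrM normr_sg ynz mulr1 ger0_norm ?divr_ge0 1?ltW //.
  lra.
by rewrite subrr normr0.
Qed.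

(** By [completion_near] the set of values is constant for small [e], so the minimum over
    completions is the only number [get] can return: two candidates are compared at a common
    radius. *)
Lemma Nmin_spec x :
  (exists2 y, completion x y & Nsgn y = Nmin x) /\
  (forall y, completion x y -> (Nmin x <= Nsgn y)%N).
Proof.
have [d d0 hd] := completion_near x.
have [y0 xy0] := completion_exists x.
pose P (k : nat) := `[< exists2 y, completion x y & Nsgn y = k >].
have exP : exists k : nat, P k by exists (Nsgn y0); apply/asboolP; exists y0.
pose k := ex_minn exP.
have [kP kmin] : P k /\ forall j : nat, P j -> (k <= j)%N.
  by rewrite /k; case: ex_minnP => k' ? ?; split.
have hk : \forall e \near 0^'+, is_minimum (Nvalues x e) k.
  near=> e; have e0 : 0 < e by near: e; exact: nbhs_right_gt.
  have ed : e < d by near: e; exact: nbhs_right_lt.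
  rewrite (hd _ e0 ed).
  split; first by move/asboolP: kP => [y ? ?]; exists y.
  by move=> j [y xy yj]; rewrite leEnat; apply: kmin; apply/asboolP; exists y.
suff -> : Nmin x = k.
  split; first exact/asboolP.
  by move=> y xy; apply: kmin; apply/asboolP; exists y.
rewrite /Nmin; apply: get_unique => // j hj.
near (0 : R)^'+ => e.
have [a b] : is_minimum (Nvalues x e) k by near: e.
have [a' b'] : is_minimum (Nvalues x e) j by near: e.
by apply/eqP; rewrite eqn_leq -!leEnat b // b'.
Unshelve. all: by end_near. Qed.

Lemma Nmax_spec x :
  (exists2 y, completion x y & Nsgn y = Nmax x) /\
  (forall y, completion x y -> (Nsgn y <= Nmax x)%N).
Proof.
have [d d0 hd] := completion_near x.
have [y0 xy0] := completion_exists x.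
pose P (k : nat) := `[< exists2 y, completion x y & Nsgn y = k >].
have exP : exists k : nat, P k by exists (Nsgn y0); apply/asboolP; exists y0.
have leP (k : nat) : P k -> (k <= n)%N by move=> /asboolP [y _ <-]; exact: Nsgn_le.
pose k := ex_maxn exP leP.
have [kP kmax] : P k /\ forall j : nat, P j -> (j <= k)%N.
  by rewrite /k; case: ex_maxnP => k' ? ?; split.
have hk : \forall e \near 0^'+, is_maximum (Nvalues x e) k.
  near=> e; have e0 : 0 < e by near: e; exact: nbhs_right_gt.
  have ed : e < d by near: e; exact: nbhs_right_lt.
  rewrite (hd _ e0 ed).
  split; first by move/asboolP: kP => [y ? ?]; exists y.
  by move=> j [y xy yj]; rewrite leEnat; apply: kmax; apply/asboolP; exists y.
suff -> : Nmax x = k.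
  split; first exact/asboolP.
  by move=> y xy; apply: kmax; apply/asboolP; exists y.
rewrite /Nmax; apply: get_unique => // j hj.
near (0 : R)^'+ => e.
have [a b] : is_maximum (Nvalues x e) k by near: e.
have [a' b'] : is_maximum (Nvalues x e) j by near: e.
by apply/eqP; rewrite eqn_leq -!leEnat b // b'.
Unshelve. all: by end_near. Qed.


Lemma Nmin_le x y : completion x y -> (Nmin x <= Nsgn y)%N.
Proof. exact: (Nmin_spec x).2. Qed.

Lemma Nmax_ge x y : completion x y -> (Nsgn y <= Nmax x)%N.
Proof. exact: (Nmax_spec x).2. Qed.

Lemma Nmin_leNmax x : (Nmin x <= Nmax x)%N.
Proof. by have [[y xy <-] _] := Nmin_spec x; exact: Nmax_ge. Qed.

Lemma odd_Nmin x : (0 < n)%N -> odd (Nmin x).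
Proof. by move=> n0; have [[y [ynz _] <-] _] := Nmin_spec x; exact: odd_Nsgn. Qed.

Lemma odd_Nmax x : (0 < n)%N -> odd (Nmax x).
Proof. by move=> n0; have [[y [ynz _] <-] _] := Nmax_spec x; exact: odd_Nsgn. Qed.

Lemma Nmax_len x : (Nmax x <= n)%N.
Proof. by have [[y _ <-] _] := Nmax_spec x; exact: Nsgn_le. Qed.

Lemma Nminmax_sub x y : (forall z, completion y z -> completion x z) ->
  (Nmin x <= Nmin y)%N /\ (Nmax y <= Nmax x)%N.
Proof.
move=> h; have [[z yz <-] _] := Nmin_spec y; have [[w yw <-] _] := Nmax_spec y.
by split; [apply: Nmin_le | apply: Nmax_ge]; exact: h.
Qed.

(** Nonzero coordinates keep their sign near [x], so every completion of a nearby point completes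
    [x]: [Nmin] is lower and [Nmax] upper semicontinuous. *)
Lemma Nminmax_near x :
  \forall y \near x, (Nmin x <= Nmin y)%N /\ (Nmax y <= Nmax x)%N.
Proof.
suff : \forall y \near x, forall i, x i 0 != 0 -> 0 < x i 0 * (y : 'cV[R]_n) i 0.
  apply: filterS => y xy; apply: Nminmax_sub => z [znz yz]; split=> // i xi.
  have h := xy i xi; apply: (pos_mulr_trans h); apply: yz.
  by apply: contraTneq h => ->; rewrite mulr0 ltxx.
have := @filter_forall 'cV[R]_n 'I_n (fun i => [set y | x i 0 != 0 -> 0 < x i 0 * y i 0]) (nbhs x) _; apply => i; have [xi|xi] := eqVneq (x i 0) 0.
  by apply: nearW.
apply/nbhs_ballP; exists `|x i 0|; rewrite /= ?normr_gt0 // => y [_ /(_ i 0)].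
by rewrite -ball_normE /= => h _; exact: mulr_gt0_dist.
Qed.

Lemma NminmaxZ x (c : R) : c != 0 -> Nmin (c *: x) = Nmin x /\ Nmax (c *: x) = Nmax x.
Proof.
have key (c' : R) x' : c' != 0 -> forall z, completion x' z -> completion (c' *: x') (c' *: z).
  move=> c0 z [znz xz]; split=> i; rewrite !mxE; first by rewrite mulf_neq0.
  rewrite mulf_eq0 negb_or => /andP [_ xi].
  by rewrite mulrACA mulr_gt0 ?xz // -expr2 exprn_even_gt0.
have hN (c' : R) z : c' != 0 -> nonvanishing z -> Nsgn (c' *: z) = Nsgn z.
  move=> c0 znz; rewrite !NsgnE; apply: eq_bigr => i _; congr (nat_of_bool _).
  rewrite /edge !mxE [X in X < 0](_ : _ = (c' ^+ 2) * (delta R i * z i 0 * z (ordS i) 0)); last by ring.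
  by rewrite pmulr_rlt0 // exprn_even_gt0.
have half (c' : R) x' : c' != 0 -> (Nmin (c' *: x') <= Nmin x')%N /\ (Nmax x' <= Nmax (c' *: x'))%N.
  move=> c0; have [[z xz <-] _] := Nmin_spec x'; have [[w xw <-] _] := Nmax_spec x'.
  split; first by rewrite -(hN c') //; [apply: Nmin_le; exact: key|case: xz].
  by rewrite -(hN c' w) //; [apply: Nmax_ge; exact: key|case: xw].
move=> c0; have [a b] := half c x c0.
have cV : c^-1 != 0 by rewrite invr_eq0.
have cK : c^-1 *: (c *: x) = x by rewrite scalerA mulVf // scale1r.
have [a' b'] := half _ (c *: x) cV; rewrite cK in a' b'.
by split; apply/eqP; rewrite eqn_leq; apply/andP; split.
Qed.

(** Two edges of equal sign at a zero coordinate both change under a flip, which moves the count by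
    two among completions of the same [x]. *)
Lemma edgeM_flip x j : (1 < n)%N -> x j 0 = 0 ->
  (exists2 y, completion x y & 0 < edge y j * edge y (ord_pred j)) ->
  (Nmin x < Nmax x)%N.
Proof.
move=> n1 xj [y xy]; have [ynz _] := xy.
have := Nsgn_flip j n1 ynz.
have := Nmin_le xy; have := Nmax_ge xy.
have xf := flip_completion xy xj.
have := Nmin_le xf; have := Nmax_ge xf.
have [h1|h1|->] := ltgtP (edge y j) 0; last by rewrite mul0r ltxx.
  rewrite (nmulr_rgt0 _ h1) => + + + + + h2; rewrite h2 (lt_gtF h2) /=.
  move=> h3 h4 h5 h6; rewrite !addnS !addn0 => h7.
  apply: (leq_ltn_trans h4); apply: (leq_trans _ h5).
  by rewrite -h7 ltnS leqnSn.
rewrite (pmulr_rgt0 _ h1) => + + + + + h2; rewrite h2 (lt_gtF h2) /=.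
move=> h3 h4 h5 h6; rewrite !addnS !addn0 => h7.
by apply: (leq_ltn_trans h6); apply: (leq_trans _ h3); rewrite h7 ltnS leqnSn.
Qed.

Lemma Ndomain_no_double_zero x j : (2 < n)%N -> Ndomain x ->
  x j 0 = 0 -> x (ordS j) 0 = 0 -> False.
Proof.
move=> n2 xN xj xSj.
suff : (Nmin x < Nmax x)%N by rewrite xN ltnn.
have n1 : (1 < n)%N by exact: ltnW.
apply: (edgeM_flip n1 xj).
have [y xy] := completion_exists x; have [ynz _] := xy.
have [h|h|h] := ltgtP (edge y j * edge y (ord_pred j)) 0; last first.
- by move/eqP: h; rewrite mulf_eq0 !(negbTE (edge_neq0 _ ynz)).
- by exists y.
(* Flipping the second zero reverses edge [j] but not edge [ord_pred j], of which it is not an end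
   as [n >= 3]; the two signs become equal. *)
exists (flip y (ordS j)); first exact: flip_completion.
have jS : (j == ordS j) = false by rewrite eq_sym (negbTE (ordS_neq _ n1)).
have pS : (ord_pred j == ordS j) = false.
  apply/negP => /eqP pj; have /eqP := ordSS_neq (ord_pred j) n2.
  by rewrite ord_predK -pj.
rewrite /edge !mxE ord_predK eqxx jS pS -/(edge y (ord_pred j)) mulrN.
move: h; rewrite /edge ord_predK mulNr oppr_gt0 //.
Qed.

(** With [n] sign changes every edge is negative, so a zero coordinate would fall under
    [edgeM_flip]. *)
Lemma Ndomain_max_nonzero x : (1 < n)%N -> Ndomain x -> Nmin x = n ->
  nonvanishing x.
Proof.
move=> n1 xN xn j; apply/eqP => xj.
suff : (Nmin x < Nmax x)%N by rewrite xN ltnn.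
apply: (edgeM_flip n1 xj); have [[y xy yN] _] := Nmin_spec x.
exists y => //; have [ynz _] := xy.
have hall i : edge y i < 0.
  apply: contraT => hi; have : (Nsgn y < n)%N.
    rewrite /Nsgn -[X in (_ < X)%N]card_ord; apply: proper_card.
    by apply/properP; split; [exact: subset_predT|exists i; rewrite // inE].
  by rewrite yN xn ltnn.
by rewrite nmulr_rgt0.
Qed.

(** At each zero the two edges of any completion have opposite signs, so a flip there only moves a
    sign change from one edge to the other. *)
Lemma Ndomain_isolated x : (1 < n)%N ->
  (forall j, x j 0 = 0 ->
    (delta R j * x (ordS j) 0) * (delta R (ord_pred j) * x (ord_pred j) 0) < 0) ->
  Ndomain x.
Proof.
move=> n1 hx.
have hedge y j : completion x y -> x j 0 = 0 -> edge y j * edge y (ord_pred j) < 0.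
  move=> [ynz xy] xj; have h := hx _ xj.
  have pS : x (ordS j) 0 != 0.
    by apply: contraTneq h => ->; rewrite mulr0 mul0r ltxx.
  have pP : x (ord_pred j) 0 != 0.
    by apply: contraTneq h => ->; rewrite !mulr0 ltxx.
  have h2 := mulr_gt0 (xy _ pS) (xy _ pP).
  have h3 : 0 < y j 0 ^+ 2 by rewrite exprn_even_gt0 //= ynz.
  have h4 : edge y j * edge y (ord_pred j) *
    ((x (ordS j) 0 * y (ordS j) 0) * (x (ord_pred j) 0 * y (ord_pred j) 0)) < 0.
    rewrite /edge ord_predK [X in X < 0](_ : _ =
      ((delta R j * x (ordS j) 0) * (delta R (ord_pred j) * x (ord_pred j) 0)) *
      (y j 0 * y (ordS j) 0 * y (ord_pred j) 0) ^+ 2); last by ring.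
    by rewrite pmulr_llt0 // exprn_even_gt0 //= !mulf_neq0.
  by rewrite pmulr_llt0 in h4.
(* Induction on the number of coordinates at which two completions disagree; each of these is a zero
   of [x]. *)
have key : forall d y z, completion x y -> completion x z ->
    #|[pred i | (y i 0 * z i 0 < 0)%R]| = d -> Nsgn y = Nsgn z.
  elim=> [|d IH] y z xy xz /=.
    move/card0_eq => h; apply: Nsgn_same => i.
    by have := h i; rewrite !inE lt_neqAle mulf_neq0 ?xy.1 ?xz.1 //= ltNge => ->.
  move=> hd; have /card_gt0P [j] : (0 < #|[pred i | (y i 0 * z i 0 < 0)%R]|)%N.
    by rewrite hd.
  rewrite inE /= => jlt.
  have xj : x j 0 = 0.
    apply/eqP; apply: contraT => xj; have := xy.2 _ xj; rewrite mulrC => h1.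
    by have := pos_mulr_trans h1 (xz.2 _ xj); rewrite (lt_gtF jlt).
  rewrite (IH y (flip z j) xy (flip_completion xz xj)); last first.
    move: hd; rewrite (cardD1 j) inE /= jlt add1n => -[<-].
    apply: eq_card => i; rewrite !inE /= mxE; case: (eqVneq i j) => // -> /=.
    by rewrite mulrN oppr_lt0 (lt_gtF jlt).
  have := Nsgn_flip j n1 xz.1; have := hedge _ _ xz xj.
  have [h1|h1|->] := ltgtP (edge z j) 0; last by rewrite mul0r ltxx.
    rewrite (nmulr_rlt0 _ h1) => h2; rewrite h2 (lt_gtF h2) /= => /eqP.
    by rewrite eqn_add2r => /eqP.
  rewrite (pmulr_rlt0 _ h1) => h2; rewrite h2 (lt_gtF h2) /= => /eqP.
  by rewrite eqn_add2r => /eqP.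
rewrite /Ndomain /mkset; have [[y xy <-] _] := Nmin_spec x.
by have [[z xz <-] _] := Nmax_spec x; exact: key xy xz erefl.
Qed.

(* The update can only flip coordinate j across an edge that already carries a
   sign change. *)
Lemma Nmin_shear x j (b : R) : (1 < n)%N -> 0 <= b ->
  (Nmin (x + (b * delta R j * x (ordS j) 0)%R *: delta_mx j 0)%R <= Nmin x)%N /\
  (Nmin (x + (b * delta R (ord_pred j) * x (ord_pred j) 0)%R *: delta_mx j 0)%R
    <= Nmin x)%N.
Proof.
move=> n1 b0; have [[y xy <-] _] := Nmin_spec x; have [ynz xyE] := xy.
have gen k e : e != 0 -> k != j ->
    (e * y k 0 * y j 0 < 0 -> (Nsgn (flip y j) <= Nsgn y)%N) ->
    (Nmin (x + (b * e * x k 0)%R *: delta_mx j 0)%R <= Nsgn y)%N.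
  move=> e0 kj hflip; set x' := x + _.
  have x'E i : i != j -> x' i 0 = x i 0.
    by move=> ij; rewrite !mxE eqxx (negbTE ij) /= mulr0 addr0.
  have x'j : x' j 0 = x j 0 + b * e * x k 0.
    by rewrite !mxE !eqxx /= mulr1.
  (* If the new coordinate does not oppose [y], then [y] still completes [x']. Otherwise the
     increment has overcome [x j 0], which forces a sign change of [y] between [k] and [j]. *)
  have [hs|hs] := leP 0 (x' j 0 * y j 0).
    apply: Nmin_le; split=> // i; have [->|ij] := eqVneq i j; last first.
      by rewrite x'E //; exact: xyE.
    by move=> h; rewrite lt_neqAle eq_sym mulf_neq0 ?ynz.
  have xyj : 0 <= x j 0 * y j 0.
    by have [->|/xyE/ltW] := eqVneq (x j 0) 0; rewrite ?mul0r.
  have h1 : (e * x k 0 * y j 0) * b < 0 by move: hs; rewrite x'j; lra.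
  have h2 : e * x k 0 * y j 0 < 0.
    by rewrite ltNge; apply/negP => h; have := mulr_ge0 h b0; rewrite leNgt h1.
  have xk : x k 0 != 0 by apply: contraTneq h2 => ->; rewrite mulr0 mul0r ltxx.
  have h3 : e * y k 0 * y j 0 < 0.
    have h := xyE _ xk; have : (e * y k 0 * y j 0) * (x k 0) ^+ 2 < 0.
      rewrite [X in X < 0](_ : _ = (e * x k 0 * y j 0) * (x k 0 * y k 0)); last by ring.
      by rewrite pmulr_llt0.
    by rewrite pmulr_llt0 // exprn_even_gt0.
  apply: leq_trans (hflip h3); apply: Nmin_le; split; first exact: flip_nonvanishing.
  move=> i; rewrite [flip _ _ _ _]mxE; have [->|ij] := eqVneq i j.
    by move=> _; rewrite mulrN oppr_gt0.
  by rewrite x'E //; exact: xyE.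
have hF := Nsgn_flip j n1 ynz.
split; apply: gen; rewrite ?delta_neq0 ?ordS_neq ?ord_pred_neq // => h.
  have h1 : edge y j < 0 by rewrite /edge mulrAC.
  move: hF; rewrite h1 (lt_gtF h1) => hF.
  rewrite -(leq_add2r 1%N) -(leq_add2r (edge y (ord_pred j) < 0)%R) -addnA hF.
  rewrite -addnA leq_add2l add0n addnC; apply: leq_trans (leq_addl _ _).
  by case: (0 < _).
have h1 : edge y (ord_pred j) < 0 by rewrite /edge ord_predK.
move: hF; rewrite h1 (lt_gtF h1) addn0 => hF.
rewrite -(leq_add2r 1%N) -(leq_add2r (edge y j < 0)%R) -addnA (addnC 1%N) hF.
by rewrite -addnA leq_add2l; apply: leq_trans (leq_addr _ _); case: (0 < _).
Qed.

Lemma Nmin_stretch x j (b : R) : 0 < 1 + b ->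
  Nmin (x + (b * x j 0) *: delta_mx j 0) = Nmin x.
Proof.
set x' := x + _ => b0.
have x'E i : x' i 0 = x i 0 * (if i == j then 1 + b else 1).
  rewrite !mxE eqxx andbT; case: eqP => [->|_]; rewrite ?mulr1 ?mulr0 ?addr0 //.
  by ring.
have pos i : 0 < (if i == j then 1 + b else 1) by case: ifP.
have hc z : completion x z <-> completion x' z.
  split=> -[znz xz]; split=> // i; have := xz i; have := pos i;
    rewrite x'E mulf_eq0 negb_or mulrAC => p0; rewrite (gt_eqF p0) andbT (pmulr_lgt0 _ p0);
    exact.
by apply/eqP; rewrite eqn_leq; apply/andP; split; apply: (Nminmax_sub _).1 => z /hc.
Qed.

End SignCount.

(** * Flow invariance of closed sets *)

Section MatrixNorm.
Variable R : realType.

Lemma mx_entry_norm (m n : nat) (B : 'M[R]_(m, n)) i j : `|B i j| <= `|B|.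
Proof.
rewrite [leRHS]/Num.norm /= mx_normrE; apply/bigmax_geP; right => /=.
by exists (i, j).
Qed.

Lemma mx_norm_le (m n : nat) (B : 'M[R]_(m, n)) (c : R) : 0 <= c ->
  (forall i j, `|B i j| <= c) -> `|B| <= c.
Proof.
by move=> c0 h; rewrite [leLHS]/Num.norm /= mx_normrE; apply/bigmax_leP; split.
Qed.

Lemma mulmx_norm_le (m n p : nat) (B : 'M[R]_(m, n)) (C : 'M[R]_(n, p)) :
  `|B *m C| <= n%:R * `|B| * `|C|.
Proof.
apply: mx_norm_le => [|i j]; first by rewrite !mulr_ge0.
rewrite mxE (le_trans (ler_norm_sum _ _ _)) //.
rewrite (@le_trans _ _ (\sum_(k < n) `|B| * `|C|)) //.
  by apply: ler_sum => k _; rewrite normrM ler_pM // mx_entry_norm.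
by rewrite sumr_const card_ord -[leLHS]mulr_natl mulrA.
Qed.

Lemma mulmx_continuous (m n p : nat) (B : 'M[R]_(m, n)) :
  continuous (fun C : 'M[R]_(n, p) => B *m C).
Proof.
move=> C V /nbhs_ballP [e /= e0 eV].
have B0 : 0 < n%:R * `|B| + 1 :> R by rewrite ltr_wpDl // mulr_ge0.
apply/nbhs_ballP; exists (e / (n%:R * `|B| + 1)); first by rewrite /= divr_gt0.
move=> D; rewrite -ball_normE /= ltr_pdivlMr // mulrC => CD.
apply: eV; rewrite -ball_normE /= -mulmxBr (le_lt_trans (mulmx_norm_le _ _)) // (le_lt_trans _ CD) //.
by rewrite ler_wpM2r // lerDl.
Qed.

End MatrixNorm.

Section FlowInvariance.
Variables (R : realType) (n : nat).
Implicit Types (x : R -> 'cV[R]_n) (B : R -> 'M[R]_n).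

Definition right_tangent x (u : R) (v : 'cV[R]_n) : Prop :=
  forall e : R, 0 < e -> exists2 d : R, 0 < d &
  forall h : R, 0 < h -> h < d -> `|x (u + h) - x u - h *: v| <= e * h.

Lemma is_derive_approx x (u : R) (v : 'cV[R]_n) : is_derive u 1 x v ->
  forall e : R, 0 < e -> exists2 d : R, 0 < d &
  forall h : R, `|h| < d -> `|x (u + h) - x u - h *: v| <= e * `|h|.
Proof.
move=> [hd hv] e e0.
have : (fun h : R => h^-1 *: ((x \o shift u) (h *: 1) - x u)) @ 0^' --> v.
  by rewrite -hv; exact: hd.
move=> /cvgrPdist_lt /(_ _ e0) [d /= d0 hdd]; exists d => // h hh.
have [->|h0] := eqVneq h 0; first by rewrite addr0 subrr scale0r subr0 !normr0 mulr0.
have := hdd h; rewrite /= sub0r normrN => /(_ hh h0).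
rewrite /shift /= scaler1 (addrC h u) => /ltW hle.
rewrite [leLHS](_ : _ = `|v - h^-1 *: (x (u + h) - x u)| * `|h|); last first.
  rewrite -[in RHS]normrN opprB mulrC -normrZ scalerBr scalerA mulfV // scale1r.
  by [].
by rewrite ler_wpM2r.
Qed.

(** Nagumo's theorem. For every [e > 0] the distance from [x u] to [K] stays below
    [e * expR ((L + 1) * (u - s))], so it is zero at [t]. *)
Lemma flow_invariance (K : set 'cV[R]_n) B x (s t L : R) : s <= t -> 0 <= L ->
  closed K -> {within `[s, t], continuous x} ->
  (forall u, s <= u <= t -> right_tangent x u (B u *m x u)) ->
  (forall u (v : 'cV[R]_n), s <= u <= t -> `|B u *m v| <= L * `|v|) ->
  (forall u, s <= u <= t -> forall e : R, 0 < e -> exists2 d : R, 0 < d &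
    forall h : R, 0 < h -> h < d -> forall y, K y ->
    exists2 y', K y' & `|y' - y - h *: (B u *m y)| <= e * h * `|y|) ->
  K (x s) -> K (x t).
Proof.
move=> st L0 Kcl xc xd BL Ktan Kxs.
(* [D u r] says that the distance from [x u] to [K] is at most [r], without asking for a nearest
   point. *)
pose D u r := forall e : R, 0 < e -> exists2 y, K y & `|x u - y| <= r + e.
have key (e : R) : 0 < e -> D t (e * expR ((L + 1) * (t - s))).
  move=> e0; pose phi u := e * expR ((L + 1) * (u - s)).
  have phi0 u : 0 < phi u by rewrite mulr_gt0 ?expR_gt0.
  have phi_homo u w : u <= w -> phi u <= phi w.
    move=> uw; rewrite /phi ler_pM2l // ler_expR; apply: ler_wpM2l; first exact: addr_ge0.
    by rewrite lerD2r.
  have phiS u h : 0 <= h -> phi u * (1 + (L + 1) * h) <= phi (u + h).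
    move=> h0; rewrite /phi -mulrA ler_pM2l //.
    rewrite (_ : (L + 1) * (u + h - s) = (L + 1) * (u - s) + (L + 1) * h); last by ring.
    by rewrite expRD ler_wpM2l ?expR_ge0 // expR_ge1Dx.
  pose T := [set u | s <= u <= t /\ forall w, s <= w <= u -> D w (phi w)].
  have Ts : T s.
    split; first by rewrite lexx.
    move=> w; rewrite -eq_le => /eqP <- r r0; exists (x s) => //.
    by rewrite subrr normr0 addr_ge0 ?ltW // phi0.
  have Tsup : has_sup T by split; [exists s|exists t => u [/andP []]].
  (* The bound holds before [tau], by left continuity also at [tau], and a short step beyond would
     contradict the supremum unless [tau = t]. *)
  pose tau := sup T.
  have stau : s <= tau by apply: ub_le_sup Ts; case: Tsup.
  have taut : tau <= t by apply: ge_sup; [exists s|move=> u [/andP []]].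
  have below w : s <= w -> w < tau -> D w (phi w).
    move=> sw wt; have [u Tu wu] := sup_gt (ex_intro _ s Ts) wt.
    by case: Tu => _; apply; rewrite sw ltW.
  have Dtau : D tau (phi tau).
    have [E|ns] := eqVneq s tau; first by case: Ts => _; apply; rewrite -E lexx.
    have slt : s < tau by rewrite lt_neqAle ns.
    move=> r r0; have r2 : 0 < r / 2 by rewrite divr_gt0.
    have : {within `[s, tau], continuous x}.
      by apply: continuous_subspaceW xc; apply: subset_itvl; rewrite bnd_simp.
    move=> /(continuous_within_itvP _ slt) [_ _].
    move=> /cvgrPdist_le /(_ _ r2) hl.
    have : \forall w \near tau^'-, s < w /\ w < tau.
      by near=> w; split; near: w; [exact: nbhs_left_gt|exact: nbhs_left_lt].
    move=> /(filterI hl) /filter_ex [w [xw [sw wt]]].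
    have [y Ky xy] := below w (ltW sw) wt _ r2; exists y => //.
    rewrite (le_trans (ler_distD (x w) _ _)) //.
    have := phi_homo _ _ (ltW wt); lra.
  have [E|nt] := eqVneq tau t; first by rewrite -E.
  have tlt : tau < t by rewrite lt_neqAle nt.
  exfalso.
  have tauI : s <= tau <= t by rewrite stau.
  pose C := `|x tau| + phi tau + 1.
  have C0 : 0 < C by rewrite ltr_wpDl // addr_ge0 // ltW.
  have e1 : 0 < phi tau / 2 by rewrite divr_gt0.
  have e2 : 0 < phi tau / (2 * C) by rewrite divr_gt0 // mulr_gt0.
  have [d1 d10 hd1] := xd _ tauI _ e1.
  have [d2 d20 hd2] := Ktan _ tauI _ e2.
  pose d := Num.min (Num.min d1 d2) (Num.min 1 (t - tau)).
  have d0 : 0 < d by rewrite !lt_min d10 d20 ltr01 subr_gt0.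
  (* The errors made for [x] and for [y'] are each at most [phi tau / 2 * h]; together they fill the
     gap between the growth rates [L] and [L + 1]. *)
  have step h : 0 < h -> h < d -> D (tau + h) (phi (tau + h)).
    move=> h0; rewrite !lt_min => /andP [/andP [h1 h2] /andP [h3 h4]] r r0.
    (* Dividing by [1 + L] compensates the amplification during the step; the cap 1 keeps the norm
       of [y] below [C]. *)
    pose r' := Num.min r 1 / (1 + L).
    have L1 : 0 < 1 + L by rewrite ltr_wpDr.
    have r'0 : 0 < r' by rewrite divr_gt0 // lt_min r0 ltr01.
    have r'r : r' * (1 + L) <= r by rewrite divfK ?gt_eqF // ge_min lexx.
    have r'1 : r' <= 1.
      rewrite ler_pdivrMr // mul1r (@le_trans _ _ 1) ?lerDl //.
      by rewrite ge_min lexx orbT.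
    have [y Ky xy] := Dtau _ r'0.
    have [y' Ky' yy'] := hd2 h h0 h2 y Ky.
    exists y' => //.
    have yC : `|y| <= C.
      have := ler_normD (y - x tau) (x tau); rewrite subrK distrC /C; lra.
    have hB : `|h *: (B tau *m (x tau - y))| <= h * (L * (phi tau + r')).
      rewrite normrZ gtr0_norm // ler_pM2l //.
      by rewrite (le_trans (BL _ _ tauI)) // ler_wpM2l.
    have E : x (tau + h) - y' = (x (tau + h) - x tau - h *: (B tau *m x tau))
       + (x tau - y) + h *: (B tau *m (x tau - y)) - (y' - y - h *: (B tau *m y)).
      rewrite mulmxBr scalerBr; move: (h *: (B tau *m x tau)) (h *: _) => p q.
      by apply/matrixP => i j; rewrite !mxE; ring.
    rewrite E.
    have N1 := ler_normB ((x (tau + h) - x tau - h *: (B tau *m x tau))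
       + (x tau - y) + h *: (B tau *m (x tau - y))) (y' - y - h *: (B tau *m y)).
    have N2 := ler_normD ((x (tau + h) - x tau - h *: (B tau *m x tau))
       + (x tau - y)) (h *: (B tau *m (x tau - y))).
    have N3 := ler_normD (x (tau + h) - x tau - h *: (B tau *m x tau)) (x tau - y).
    have N4 := hd1 h h0 h1.
    have N5 : phi tau / (2 * C) * h * `|y| <= phi tau / 2 * h.
      rewrite [leRHS](_ : _ = phi tau / (2 * C) * h * C); last first.
        by field; rewrite gt_eqF.
      by apply: ler_wpM2l => //; apply: mulr_ge0; apply: ltW.
    have N6 := phiS tau h (ltW h0).
    have N7 : h * (L * r') <= L * r' by apply: ler_piMl (ltW h3); apply: mulr_ge0 L0 (ltW r'0).
    lra.
  have : T (tau + d / 2).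
    have hd : d / 2 < d by rewrite ltr_pdivrMr // mulr2n mulrDr mulr1 ltrDl.
    have dt : d <= t - tau by rewrite !ge_min lexx !orbT.
    split; first by apply/andP; split; lra.
    move=> w /andP [sw wd]; have [wt|wt|->//] := ltgtP w tau.
      exact: below.
    have -> : w = tau + (w - tau) by rewrite addrC subrK.
    by apply: step; lra.
  move=> /(ub_le_sup Tsup.2); rewrite -/tau; lra.
apply: Kcl => V /nbhs_ballP [r /= r0 rV].
pose E := expR ((L + 1) * (t - s)).
have E0 : 0 < E by exact: expR_gt0.
have e0 : 0 < r / (3 * E) by rewrite divr_gt0 // mulr_gt0.
have r3 : 0 < r / 3 by rewrite divr_gt0.
have [y Ky xy] := key _ e0 _ r3; exists y; split=> //.
apply: rV; rewrite -ball_normE /= (le_lt_trans xy) //.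
have -> : r / (3 * E) * E = r / 3 by field; rewrite gt_eqF.
lra.
Unshelve. all: by end_near. Qed.

End FlowInvariance.

(** * Sign changes along the flow *)

Section Tangent.
Variables (R : realType) (n : nat).
Hypothesis n3 : (3 <= n)%N.
Implicit Types (B : 'M[R]_n) (y : 'cV[R]_n).

(** Nagumo's condition for all the sets of bounded [Nmin] at once, with a step size that does not
    depend on [y]. *)
Definition subtangent B : Prop := forall e : R, 0 < e -> exists2 d : R, 0 < d &
  forall h : R, 0 < h -> h < d -> forall y,
  exists2 y', (Nmin y' <= Nmin y)%N & `|y' - y - h *: (B *m y)| <= e * h * `|y|.

Lemma subtangent0 : subtangent 0.
Proof.
move=> e e0; exists 1 => // h h0 _ y; exists y => //.
by rewrite mul0mx scaler0 subr0 subrr normr0 !mulr_ge0 // ltW.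
Qed.

Lemma subtangent_exact B (d : R) : 0 < d ->
  (forall h : R, 0 < h -> h < d -> forall y, (Nmin (y + h *: (B *m y)) <= Nmin y)%N) ->
  subtangent B.
Proof.
move=> d0 hB e e0; exists d => // h h0 hd y; exists (y + h *: (B *m y)).
  exact: hB.
by rewrite (addrC y) addrK subrr normr0 !mulr_ge0 // ltW.
Qed.

(** Following [B] and then [C] costs only an error of second order in [h], from applying [C] at [y1]
    instead of [y]. *)
Lemma subtangentD B C : subtangent B -> subtangent C -> subtangent (B + C).
Proof.
move=> hB hC e e0.
have e4 : 0 < e / 4 by rewrite divr_gt0.
pose b := n%:R * `|B|; pose c := n%:R * `|C|.
have b0 : 0 <= b by rewrite mulr_ge0.
have c0 : 0 <= c by rewrite mulr_ge0.
have [d1 d10 h1] := hB _ e4; have [d2 d20 h2] := hC _ e4.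
pose d3 := Num.min (e / (4 * (e / 4 + b + 1) * (c + 1))) (1 / (e / 4 + b + 1)).
have q0 : 0 < e / 4 + b + 1 by lra.
have c10 : 0 < c + 1 by lra.
have d30 : 0 < d3 by rewrite lt_min !divr_gt0 // !mulr_gt0.
exists (Num.min (Num.min d1 d2) d3); first by rewrite lt_min d30 lt_min d10 d20.
move=> h h0; rewrite !lt_min => /andP [/andP [hd1 hd2] /andP [hd3 hd4]] y.
have [y1 N1 E1] := h1 h h0 hd1 y; have [y2 N2 E2] := h2 h h0 hd2 y1.
exists y2; first exact: leq_trans N2 N1.
have nC (v : 'cV[R]_n) : `|C *m v| <= c * `|v| by exact: mulmx_norm_le.
have nB (v : 'cV[R]_n) : `|B *m v| <= b * `|v| by exact: mulmx_norm_le.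
have E : y2 - y - h *: ((B + C) *m y) = (y2 - y1 - h *: (C *m y1))
    + (y1 - y - h *: (B *m y)) + h *: (C *m (y1 - y)).
  rewrite mulmxDl mulmxBr !scalerBr scalerDr.
  move: (h *: _) (h *: _) (h *: _) => p q r.
  by apply/matrixP => i j; rewrite !mxE; ring.
rewrite E.
have y0 : 0 <= `|y| by [].
have D1 : `|y1 - y| <= h * (e / 4 + b + 1) * `|y|.
  have := ler_normD (y1 - y - h *: (B *m y)) (h *: (B *m y)).
  rewrite subrK normrZ (gtr0_norm h0) => /le_trans; apply.
  have := ler_wpM2l (ltW h0) (nB y); have := mulr_ge0 (ltW h0) y0; lra.
have D2 : `|y1| <= 2 * `|y|.
  have := ler_normD (y1 - y) y; rewrite subrK => /le_trans; apply.
  have : h * (e / 4 + b + 1) <= 1.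
    by rewrite -ler_pdivlMr // ltW.
  by move=> /(ler_wpM2r y0); lra.
have T1 := ler_normD ((y2 - y1 - h *: (C *m y1)) + (y1 - y - h *: (B *m y))) (h *: (C *m (y1 - y))).
have T2 := ler_normD (y2 - y1 - h *: (C *m y1)) (y1 - y - h *: (B *m y)).
have T3 : `|h *: (C *m (y1 - y))| <= e / 4 * h * `|y|.
  rewrite normrZ (gtr0_norm h0) (mulrC _ h) -mulrA ler_pM2l //.
  rewrite (le_trans (nC _)) // (@le_trans _ _ ((c + 1) * (h * (e / 4 + b + 1) * `|y|))) //.
    by rewrite ler_pM // lerDl.
  have : h * (4 * (e / 4 + b + 1) * (c + 1)) <= e.
    by rewrite -ler_pdivlMr ?ltW // !mulr_gt0.
  by move=> /(ler_wpM2r y0); lra.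
have T4 : e / 4 * h * `|y1| <= e / 4 * h * (2 * `|y|).
  by rewrite ler_wpM2l // mulr_ge0 ?ltW.
lra.
Qed.

Lemma mul_delta_mx_cv (p : nat) (i : 'I_p) (j : 'I_n) y :
  delta_mx i j *m y = y j 0 *: delta_mx i 0.
Proof.
apply/matrixP => k l; rewrite !mxE (bigD1 j) //= big1 => [|m mj].
  by rewrite !mxE !eqxx andbT addr0 ord1 eqxx andbT mulrC.
by rewrite !mxE (negbTE mj) andbF mul0r.
Qed.

Lemma delta_sqr (i : 'I_n) : delta R i * delta R i = 1.
Proof. by rewrite /delta; case: ifP; rewrite ?mulrNN mulr1. Qed.

Lemma subtangent_diag (i : 'I_n) (a : R) : subtangent (a *: delta_mx i i).
Proof.
apply: (@subtangent_exact _ (1 / (`|a| + 1))) => [|h h0 hd y].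
  by rewrite divr_gt0 // ltr_wpDl.
have q0 : 0 < `|a| + 1 by rewrite ltr_wpDl.
rewrite -scalemxAl mul_delta_mx_cv !scalerA Nmin_stretch //.
move: hd; rewrite (ltr_pdivlMr _ _ q0) => hd.
have := ler_norm (- a); rewrite normrN => /(ler_wpM2l (ltW h0)); lra.
Qed.

Lemma subtangent_upper (i : 'I_n) (a : R) : 0 <= a * delta R i ->
  subtangent (a *: delta_mx i (ordS i)).
Proof.
move=> a0; apply: (subtangent_exact ltr01) => h h0 hd y.
rewrite -scalemxAl mul_delta_mx_cv !scalerA.
have -> : h * a * y (ordS i) 0 = (h * (a * delta R i)) * delta R i * y (ordS i) 0.
  by rewrite (mulrA h) -(mulrA (h * a)) delta_sqr mulr1.
by apply: (Nmin_shear _ _ _ _).1; [exact: ltnW|rewrite mulr_ge0 // ltW].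
Qed.

Lemma subtangent_lower (i : 'I_n) (a : R) : 0 <= a * delta R i ->
  subtangent (a *: delta_mx (ordS i) i).
Proof.
move=> a0; apply: (subtangent_exact ltr01) => h h0 hd y.
rewrite -scalemxAl mul_delta_mx_cv !scalerA.
have -> : h * a * y i 0 = (h * (a * delta R i)) * delta R i * y i 0.
  by rewrite (mulrA h) -(mulrA (h * a)) delta_sqr mulr1.
have := (@Nmin_shear R n y (ordS i) (h * (a * delta R i)) (ltnW n3) _).2.
by rewrite ordSK; apply; rewrite mulr_ge0 // ltW.
Qed.

(** For [n >= 3] the three families of positions are disjoint, so no entry is counted twice. *)
Lemma cyclic_decomposition B :
  (forall i j, B i j != 0 -> [\/ j = i, j = ordS i | i = ordS j]) ->
  B = \sum_i (B i i *: delta_mx i i + B i (ordS i) *: delta_mx i (ordS i)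
              + B (ordS i) i *: delta_mx (ordS i) i).
Proof.
move=> hB; have S1 i := ordS_neq i (ltnW n3).
have SS i := ordSS_neq i n3.
apply/matrixP => k l; rewrite summxE.
under eq_bigr do rewrite !mxE.
rewrite !big_split /=.
have -> : \sum_i B i i * ((k == i) && (l == i))%:R = B k k * (l == k)%:R.
  rewrite (bigD1 k) //= big1 ?addr0 ?eqxx // => i ik.
  by rewrite eq_sym (negbTE ik) mulr0.
have -> : \sum_i B i (ordS i) * ((k == i) && (l == ordS i))%:R =
    B k (ordS k) * (l == ordS k)%:R.
  rewrite (bigD1 k) //= big1 ?addr0 ?eqxx // => i ik.
  by rewrite (eq_sym k) (negbTE ik) mulr0.
have -> : \sum_i B (ordS i) i * ((k == ordS i) && (l == i))%:R =
    B (ordS l) l * (k == ordS l)%:R.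
  rewrite (bigD1 l) //= big1 ?addr0 ?eqxx ?andbT // => i il.
  by rewrite (eq_sym l) (negbTE il) andbF mulr0.
have [->|lk] := eqVneq l k.
  by rewrite eq_sym (negbTE (S1 k)) !mulr0 !addr0 mulr1.
have [->|lSk] := eqVneq l (ordS k).
  by rewrite eq_sym (negbTE (SS k)) !mulr0 add0r addr0 mulr1.
have [->|kSl] := eqVneq k (ordS l); first by rewrite !mulr0 !add0r mulr1.
rewrite !mulr0 !addr0; apply/eqP/negPn/negP => /hB [] h.
- by rewrite h eqxx in lk.
- by rewrite h eqxx in lSk.
- by rewrite h eqxx in kSl.
Qed.

Lemma feedback_delta (u : 'I_n -> R) : negative_feedback u ->
  forall i, 0 < u i * delta R i.
Proof.
move=> [h1 h2] i; rewrite /delta; case: eqP => [/h2|/eqP hi].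
  by rewrite mulrN1 oppr_gt0.
by rewrite mulr1 h1 // ltn_neqAle hi ltn_ord.
Qed.

(** Negative feedback fixes the signs of one family strictly; the other inherits them weakly because
    paired entries have a nonnegative product. *)
Lemma Mminus_signs B : Mminus B -> forall i,
  0 <= upper_entry B i * delta R i /\ 0 <= lower_entry B i * delta R i.
Proof.
move=> [_ hp _ hf] i.
have h : 0 <= (upper_entry B i * delta R i) * (lower_entry B i * delta R i).
  by rewrite mulrACA delta_sqr mulr1.
case: hf => /feedback_delta /(_ i) hi; split; try exact: ltW.
  by move: h; rewrite pmulr_rge0.
by move: h; rewrite pmulr_lge0.
Qed.

Lemma subtangent_Mminus B : Mminus B -> subtangent B.
Proof.
move=> BM; have [hB _ _ _] := BM; rewrite (cyclic_decomposition hB).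
apply: (big_ind subtangent); [exact: subtangent0|exact: subtangentD|move=> i _].
have [hu hl] := Mminus_signs BM i.
apply: subtangentD; last exact: subtangent_lower.
apply: subtangentD; [exact: subtangent_diag|exact: subtangent_upper].
Qed.

Lemma Nmin_le_closed (c : nat) : closed [set y : 'cV[R]_n | (Nmin y <= c)%N].
Proof.
move=> y hy; have /= [z [/= zc [h _]]] := hy _ (Nminmax_near y).
exact: leq_trans h zc.
Qed.

End Tangent.

(** * Solutions: uniqueness and monotonicity of the sign counts *)

Section Flow.
Variables (R : realType) (n : nat) (alpha beta : \bar R) (A : R -> 'M[R]_n).
Hypothesis n3 : (3 <= n)%N.
Hypothesis Ac : forall u, oitv alpha beta u -> {for u, continuous A}.
Hypothesis AM : forall u, oitv alpha beta u -> Mminus (A u).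
Implicit Types (x : R -> 'cV[R]_n) (u s t : R).

Lemma oitv_between s t u : oitv alpha beta s -> oitv alpha beta t ->
  s <= u <= t -> oitv alpha beta u.
Proof.
move=> [s1 s2] [t1 t2] /andP [su ut]; split.
  by rewrite (lt_le_trans s1) // lee_fin.
by rewrite (le_lt_trans _ t2) // lee_fin.
Qed.

Lemma solution_continuous x u : is_solution alpha beta A x -> oitv alpha beta u ->
  {for u, continuous x}.
Proof.
by move=> xs /xs [hd _]; apply: differentiable_continuous; apply/derivable1_diffP.
Qed.

Lemma within_oitv_continuous (V : topologicalType) (f : R -> V) s t :
  oitv alpha beta s -> oitv alpha beta t ->
  (forall u, oitv alpha beta u -> {for u, continuous f}) ->
  {within `[s, t], continuous f}.
Proof.
move=> hs ht fc; apply: continuous_in_subspaceT => u; rewrite inE /= in_itv /= => h.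
exact/fc/(oitv_between hs ht).
Qed.

Lemma operator_bound s t : oitv alpha beta s -> oitv alpha beta t ->
  exists2 L : R, 0 <= L &
    forall u (v : 'cV[R]_n), s <= u <= t -> `|A u *m v| <= L * `|v|.
Proof.
move=> hs ht; have cA := within_oitv_continuous hs ht Ac.
have cK := @continuous_compact _ _ _ _ cA (@segment_compact R s t).
have [M [_ hM]] := compact_bounded cK.
pose L := Num.max (M + 1) 0.
have L0 : 0 <= L by rewrite le_max lexx orbT.
exists (n%:R * L) => [|u v hu]; first exact: mulr_ge0.
rewrite (le_trans (mulmx_norm_le _ _)) // ler_wpM2r // ler_wpM2l //.
rewrite (@le_trans _ _ (M + 1)) ?le_max ?lexx //.
by apply: (hM (M + 1)); rewrite ?ltrDl //; exists u => //; rewrite /= in_itv.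
Qed.

Lemma solution_right_tangent x u : is_solution alpha beta A x ->
  oitv alpha beta u -> right_tangent x u (A u *m x u).
Proof.
move=> xs /xs /is_derive_approx hx e /hx [d d0 hd]; exists d => // h h0 hh.
by have := hd h; rewrite gtr0_norm //; apply.
Qed.

(** Nagumo's condition is trivial for the set containing only 0; this is forward uniqueness. *)
Lemma solution_zero_forward x s t : is_solution alpha beta A x ->
  oitv alpha beta s -> oitv alpha beta t -> s <= t -> x s = 0 -> x t = 0.
Proof.
move=> xs hs ht st x0; have [L L0 hL] := operator_bound hs ht.
apply: (flow_invariance (K := [set 0]) (B := A) st L0 _ _ _ hL) => //.
- by apply: accessible_closed_set1; apply: hausdorff_accessible; exact: norm_hausdorff.
- by apply: within_oitv_continuous => // u; exact: solution_continuous.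
- by move=> u hu; apply: solution_right_tangent; last exact: (oitv_between hs ht).
move=> u hu e e0; exists 1 => // h h0 _ y ->; exists 0 => //.
by rewrite mulmx0 scaler0 !subr0 normr0 mulr0.
Qed.

(** Reversing time, [x (- u)] solves the equation with matrix [- A (- u)], to which the forward
    argument applies. *)
Lemma solution_zero_backward x s t : is_solution alpha beta A x ->
  oitv alpha beta s -> oitv alpha beta t -> s <= t -> x t = 0 -> x s = 0.
Proof.
move=> xs hs ht st x0; have [L L0 hL] := operator_bound hs ht.
have opp u : - t <= u <= - s -> s <= - u <= t.
  by move=> /andP [? ?]; apply/andP; split; lra.
suff : [set 0] (x (- (- s))) by rewrite opprK.
apply: (@flow_invariance R n [set 0] (fun u => - A (- u)) (fun u => x (- u)) (- t) (- s) L).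
- by rewrite lerN2.
- exact: L0.
- by apply: accessible_closed_set1; apply: hausdorff_accessible; exact: norm_hausdorff.
- apply: continuous_in_subspaceT => u; rewrite inE /= in_itv /= => /opp hu.
  apply: continuous_comp; first exact: opp_continuous.
  by apply: solution_continuous => //; exact: (oitv_between hs ht).
- move=> u /opp hu e e0; have hu' := oitv_between hs ht hu.
  have [d d0 hd] := is_derive_approx (xs _ hu') e0; exists d => // h h0 hh.
  have := hd (- h); rewrite normrN gtr0_norm // => /(_ hh).
  by rewrite opprD mulNmx scalerN scaleNr.
- by move=> u v /opp hu; rewrite mulNmx normrN; exact: hL.
- move=> u hu e e0; exists 1 => // h h0 _ y ->; exists 0 => //.
  by rewrite mulmx0 scaler0 !subr0 normr0 mulr0.
- by rewrite opprK.
Qed.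

Lemma Nmin_flow x s t : is_solution alpha beta A x ->
  oitv alpha beta s -> oitv alpha beta t -> s <= t ->
  (Nmin (x t) <= Nmin (x s))%N.
Proof.
move=> xs hs ht st; have [L L0 hL] := operator_bound hs ht.
apply: (flow_invariance (K := [set y | (Nmin y <= Nmin (x s))%N]) (B := A)
  st L0 _ _ _ hL) => //.
- exact: Nmin_le_closed.
- by apply: within_oitv_continuous => // u; exact: solution_continuous.
- by move=> u hu; apply: solution_right_tangent; last exact: (oitv_between hs ht).
- move=> u hu e e0; have hu' := oitv_between hs ht hu.
have [d d0 hd] := subtangent_Mminus n3 (AM hu') e0.
exists d => // h h0 hh y /= yN; have [y' y'N Ey] := hd h h0 hh y.
exists y'; last exact: Ey.
by rewrite /mkset; exact: leq_trans y'N yN.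
by rewrite /mkset leqnn.
Qed.

Lemma solution_coord0 x u (i : 'I_n) (d : R) : is_solution alpha beta A x ->
  oitv alpha beta u -> 0 < d -> (forall h, `|h| < d -> x (u + h) i 0 = 0) ->
  (A u *m x u) i 0 = 0.
Proof.
move=> /[swap] hu /(_ _ hu); move: (A u *m x u) => w hw d0 hz.
apply/eqP; apply: contraT => D0.
have e0 : 0 < `|w i 0| / 2 by rewrite divr_gt0 // normr_gt0.
have [d' d'0 hd] := is_derive_approx hw e0.
pose h := Num.min d d' / 2.
have m0 : 0 < Num.min d d' by rewrite lt_min d0.
have h0 : 0 < h by rewrite divr_gt0.
have hm : h < Num.min d d' by rewrite /h; lra.
have /andP [h1 h2] : (h < d) && (h < d') by rewrite -lt_min.
have := hd h; rewrite (gtr0_norm h0) => /(_ h2).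
move=> /(le_trans (mx_entry_norm _ i 0)).
have x1 := hz h; rewrite (gtr0_norm h0) in x1.
have x2 := hz 0; rewrite normr0 addr0 in x2.
rewrite !mxE x1 // x2 // subrr sub0r normrN normrM (gtr0_norm h0) mulrC.
by rewrite ler_pM2r // leNgt ltr_pdivrMr // ltr_pMr ?normr_gt0 // ltr1n.
Qed.

(** The coordinates are treated one by one: the next one either vanishes on the whole current
    interval or is nonzero at a point, hence on a smaller interval around it. *)
Lemma coord_dichotomy x s t (k : nat) : is_solution alpha beta A x ->
  oitv alpha beta s -> oitv alpha beta t -> s < t ->
  exists s' t', [/\ s <= s', s' < t', t' <= t & forall i : 'I_n, (i < k)%N ->
    (forall u, s' < u < t' -> x u i 0 = 0) \/
    (forall u, s' < u < t' -> x u i 0 != 0)].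
Proof.
move=> xs hs ht st; elim: k => [|k [s' [t' [ss st' tt IH]]]].
  by exists s, t; split.
have [kn|nk] := ltnP k n; last first.
  exists s', t'; split=> // i _; apply: IH; exact: leq_trans (ltn_ord i) nk.
pose j := Ordinal kn.
have [h|/existsNP [u /not_implyP [/andP [su ut] /eqP xu]]] :=
  pselect (forall u, s' < u < t' -> x u j 0 = 0).
  exists s', t'; split=> // i; rewrite ltnS leq_eqVlt => /predU1P [ik|/IH//].
  by left; rewrite (_ : i = j) //; exact: val_inj.
have hu : oitv alpha beta u by apply: (oitv_between hs ht); apply/andP; split; lra.
have /cvgrPdist_lt /(_ `|x u j 0|) := solution_continuous xs hu.
rewrite normr_gt0 => /(_ xu) /nbhs_ballP [d /= d0 hd].
have xnz w : `|u - w| < d -> x w j 0 != 0.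
  move=> uw; have := hd w; rewrite -ball_normE /= => /(_ uw).
  have := mx_entry_norm (x u - x w) j 0; rewrite !mxE => /le_lt_trans h /h.
  by move=> /mulr_gt0_dist; apply: contraTneq => ->; rewrite mulr0 ltxx.
exists (Num.max s' (u - d)), (Num.min t' (u + d)); split.
- by rewrite le_max ss.
- by rewrite gt_max !lt_min; apply/andP; split; apply/andP; split; lra.
- by rewrite ge_min tt.
move=> i; rewrite ltnS leq_eqVlt => /predU1P [ik|/IH h].
  right; rewrite (_ : i = j) //; last exact: val_inj.
  move=> w; rewrite gt_max lt_min => /andP [/andP [_ ?] /andP [_ ?]].
  by apply: xnz; rewrite ltr_norml; apply/andP; split; lra.
by case: h => h; [left|right] => w; rewrite gt_max lt_min;
  move=> /andP [/andP [? _] /andP [? _]]; apply: h; apply/andP.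
Qed.

Lemma iter_ordS_surj (i j : 'I_n) : exists k, j = iter k (@ordS n) i.
Proof.
have vE k : iter k (@ordS n) i = ((i + k) %% n)%N :> nat.
  elim: k => [|k IH]; first by rewrite addn0 modn_small.
  by rewrite iterS /= IH addnS -addn1 modnDml addn1.
exists (n - i + j)%N; apply: val_inj; rewrite /= vE addnA subnKC ?(ltnW (ltn_ord _)) //.
by rewrite modnDl modn_small.
Qed.

Lemma cyclic_row (B : 'M[R]_n) (y : 'cV[R]_n) (i : 'I_n) : Mminus B -> y i 0 = 0 ->
  (B *m y) i 0 = upper_entry B i * y (ordS i) 0 +
    lower_entry B (ord_pred i) * y (ord_pred i) 0.
Proof.
move=> [hB _ _ _] yi; rewrite mxE (bigD1 (ordS i)) //= (bigD1 (ord_pred i)) /=.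
  rewrite /upper_entry /lower_entry ord_predK big1 ?addr0 // => j /andP [jS jp].
  apply/eqP; rewrite mulf_eq0; apply: contraT; rewrite negb_or => /andP [/hB [] h yj].
  - by rewrite h yi eqxx in yj.
  - by rewrite h eqxx in jS.
  - by rewrite h ordSK eqxx in jp.
by apply/eqP => h; have /eqP := ordSS_neq (ord_pred i) n3; rewrite ord_predK h.
Qed.

(** At a zero coordinate the hypothesis reads [p i * X i + q i * Y i = 0] with nonnegative weights,
    one family being positive. So zeros are not adjacent and the twisted neighbours have opposite
    signs, as [Ndomain_isolated] requires. *)
Lemma Mminus_annihilates (B : 'M[R]_n) (y : 'cV[R]_n) : Mminus B -> y != 0 ->
  (forall i, y i 0 = 0 -> (B *m y) i 0 = 0) -> Ndomain y.
Proof.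
move=> BM y0 hz; have hs := Mminus_signs BM.
pose X i := delta R i * y (ordS i) 0.
pose Y i := delta R (ord_pred i) * y (ord_pred i) 0.
pose p i := upper_entry B i * delta R i.
pose q i := lower_entry B (ord_pred i) * delta R (ord_pred i).
have p0 i : 0 <= p i by exact: (hs i).1.
have q0 i : 0 <= q i by exact: (hs _).2.
have eqn i : y i 0 = 0 -> p i * X i + q i * Y i = 0.
  move=> yi; rewrite -(hz i yi) (cyclic_row BM yi) /p /q /X /Y.
  by rewrite -!mulrA !(mulrA (delta R _) (delta R _)) !delta_sqr !mul1r.
have X0 i : (X i == 0) = (y (ordS i) 0 == 0).
  by rewrite mulf_eq0 (negbTE (delta_neq0 _ _)).
have Y0 i : (Y i == 0) = (y (ord_pred i) 0 == 0).
  by rewrite mulf_eq0 (negbTE (delta_neq0 _ _)).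
have [_ _ _ hf] := BM.
have nocons i : y i 0 = 0 -> y (ordS i) 0 = 0 -> False.
  move=> yi ySi; move/eqP: y0; apply; apply/matrixP => j k; rewrite ord1 mxE.
  suff [] : y j 0 = 0 /\ y (ordS j) 0 = 0 by [].
  (* Two adjacent zeros spread forward around the cycle if all [p] are positive, and backward if all
     [q] are. *)
  case: hf => /feedback_delta hf.
    have [m ->] := iter_ordS_surj i j.
    elim: m => //= m [IH1 IH2]; split=> //.
    have := eqn _ IH2; have /eqP -> : Y (ordS (iter m (@ordS n) i)) == 0.
      by rewrite Y0 ordSK IH1.
    rewrite mulr0 addr0 => /eqP; rewrite mulf_eq0 gt_eqF ?hf //= X0.
    by move/eqP.
  have [m im] := iter_ordS_surj j i; elim: m i yi ySi im => [|m IH] i yi ySi im.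
    by rewrite -[j]im.
  apply: (IH (ord_pred i)); rewrite ?ord_predK //; last by rewrite im iterS ordSK.
  have := eqn _ yi; have /eqP -> : X i == 0 by rewrite X0 ySi.
  rewrite mulr0 add0r => /eqP; rewrite mulf_eq0 gt_eqF ?hf //= Y0.
  by move/eqP.
apply: Ndomain_isolated => [|i yi]; first exact: ltnW.
rewrite -/(X i) -/(Y i).
have Xn : X i != 0 by rewrite X0; apply/eqP; exact: nocons.
have Yn : Y i != 0.
  by rewrite Y0; apply/eqP => h; apply: (nocons (ord_pred i)); rewrite ?ord_predK.
have e := eqn i yi.
rewrite ltNge le_eqVlt negb_or eq_sym mulf_neq0 //=; apply/negP => XY.
(* Multiplying the relation by [X i] or by [Y i] leaves a square with positive weight plus a
   nonnegative term. *)
have e1 : p i * (X i * X i) + q i * (X i * Y i) = 0.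
  by rewrite -[RHS](mul0r (X i)) -e; ring.
have e2 : p i * (X i * Y i) + q i * (Y i * Y i) = 0.
  by rewrite -[RHS](mul0r (Y i)) -e; ring.
have XX : 0 < X i * X i by rewrite -expr2 exprn_even_gt0.
have YY : 0 < Y i * Y i by rewrite -expr2 exprn_even_gt0.
case: hf => /feedback_delta hf.
  have := mulr_gt0 (hf i : 0 < p i) XX; have := mulr_ge0 (q0 i) (ltW XY); lra.
have := mulr_gt0 (hf (ord_pred i) : 0 < q i) YY; have := mulr_ge0 (p0 i) (ltW XY); lra.
Qed.

(** The midpoint of the interval given by [coord_dichotomy] works: a coordinate that is zero there
    is zero nearby, so its derivative vanishes too. *)
Lemma exists_Ndomain x s t : is_solution alpha beta A x ->
  oitv alpha beta s -> oitv alpha beta t -> s < t ->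
  (forall u, s < u < t -> x u != 0) -> exists2 u, s < u < t & Ndomain (x u).
Proof.
move=> xs hs ht st xnz.
have [s' [t' [ss st' tt hd]]] := coord_dichotomy n xs hs ht st.
pose u := (s' + t') / 2; have su : s' < u by rewrite /u; lra.
have ut : u < t' by rewrite /u; lra.
have hsut : s < u < t by apply/andP; split; lra.
exists u => //; have hu : oitv alpha beta u.
  by apply: (oitv_between hs ht); apply/andP; split; lra.
apply: (Mminus_annihilates (AM hu)) => [|i xi]; first exact: xnz.
have [z|nz] := hd i (ltn_ord i); last first.
  by have := nz u; rewrite su ut xi eqxx => /(_ isT).
apply: (@solution_coord0 _ _ _ ((t' - s') / 2) xs hu); first lra.
move=> h; rewrite ltr_norml => /andP [? ?]; apply: z.
by rewrite /u; apply/andP; split; lra.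
Qed.

Lemma Nmin_nonvanishing (z : 'cV[R]_n) : nonvanishing z -> Nmin z = Nsgn z.
Proof.
move=> znz; have [[y [_ yz] <-] _] := Nmin_spec z.
by apply/esym/Nsgn_same => i; exact: yz.
Qed.

Variable S : R -> R -> 'M[R]_n.
Hypothesis Ssol : is_solution_operator alpha beta A S.

Lemma solutionB x y : is_solution alpha beta A x -> is_solution alpha beta A y ->
  is_solution alpha beta A (fun u => x u - y u).
Proof.
by move=> hx hy u hu; rewrite mulmxBr; apply: is_deriveB; [exact: hx|exact: hy].
Qed.

Lemma solution_operator_uniq x s t : is_solution alpha beta A x ->
  oitv alpha beta s -> oitv alpha beta t -> S s t *m x s = x t.
Proof.
move=> xs hs ht; have [S1 S2] := Ssol (x s) hs.
have h := solutionB S2 xs; apply/eqP; rewrite -subr_eq0; apply/eqP.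
have [st|ts] := leP s t.
  by apply: (solution_zero_forward h hs ht st); rewrite S1 subrr.
by apply: (solution_zero_backward h ht hs (ltW ts)); rewrite S1 subrr.
Qed.

(** The final value is perturbed instead of the initial one: adding a small multiple of a completion
    with maximal count gives a nonvanishing vector whose count is [Nmax (x t)]. Pulled back to a
    time [u] with [x u] in [Ndomain], it is close to [x u], and weak monotonicity on both sides of
    [u] concludes. *)
Lemma Nmax_flow x s t : is_solution alpha beta A x ->
  oitv alpha beta s -> oitv alpha beta t -> s < t -> x t != 0 ->
  (Nmax (x t) <= Nmin (x s))%N.
Proof.
move=> xs hs ht st xt0.
have hb u : s < u < t -> oitv alpha beta u.
  by move=> /andP [? ?]; apply: (oitv_between hs ht); apply/andP; split; lra.
have [u sut uN] : exists2 u, s < u < t & Ndomain (x u).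
  apply: exists_Ndomain => // u sut; apply: contra xt0 => /eqP xu0.
  apply/eqP; apply: (solution_zero_forward xs (hb u sut) ht _ xu0).
  by case/andP: sut => _ /ltW.
have hu := hb u sut; have /andP [su ut] := sut.
have [[z [znz xz] <-] _] := Nmax_spec (x t).
have [r r0 hr] : exists2 r : R, 0 < r &
    forall y, `|x u - y| < r -> (Nmax y <= Nmax (x u))%N.
  have /nbhs_ballP [r /= r0 hr] := Nminmax_near (x u).
  by exists r => // y xy; apply: (hr y _).2; rewrite -ball_normE.
pose v := S t u *m z.
(* This makes the perturbation [l *: v] at time [u] smaller than the radius [r]. *)
pose l := r / (`|v| + 1).
have v1 : 0 < `|v| + 1 by rewrite ltr_wpDl.
have l0 : 0 < l by rewrite divr_gt0.
pose zl := x t + l *: z.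
have zlz i : 0 < zl i 0 * z i 0.
  rewrite !mxE mulrDl -mulrA ltr_wpDl //.
    by have [->|/xz/ltW] := eqVneq (x t i 0) 0; rewrite ?mul0r.
  by rewrite mulr_gt0 // -expr2 exprn_even_gt0 //= znz.
have zlnz : nonvanishing zl.
  by move=> i; apply: contraTneq (zlz i) => ->; rewrite mul0r ltxx.
rewrite -(Nsgn_same zlz) -Nmin_nonvanishing //.
have [S1 S2] := Ssol zl ht.
rewrite -{1}S1; apply: leq_trans (Nmin_flow S2 hu ht (ltW ut)) _.
apply: leq_trans (Nmin_leNmax _) _.
apply: leq_trans (hr _ _) _; last first.
  by rewrite -uN; exact: (Nmin_flow xs hs hu (ltW su)).
rewrite mulmxDr (solution_operator_uniq xs ht hu) -scalemxAr opprD addrA subrr.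
rewrite sub0r normrN normrZ (gtr0_norm l0) -/v /l mulrAC ltr_pdivrMr //.
by rewrite ltr_pM2l // ltrDl.
Qed.

Lemma solution_operatorK s t (v : 'cV[R]_n) :
  oitv alpha beta s -> oitv alpha beta t -> S t s *m (S s t *m v) = v.
Proof.
move=> hs ht; have [S1 S2] := Ssol v hs.
by rewrite (solution_operator_uniq S2 ht hs).
Qed.

Lemma Nmax_solution_operator s t (v : 'cV[R]_n) :
  oitv alpha beta s -> oitv alpha beta t -> s < t -> v != 0 ->
  (Nmax (S s t *m v) <= Nmin v)%N.
Proof.
move=> hs ht st v0; have [S1 S2] := Ssol v hs.
rewrite -[in leqRHS]S1; apply: (Nmax_flow S2 hs ht st).
apply: contra v0 => /eqP h; rewrite -(solution_operatorK v hs ht) h.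
by rewrite mulmx0.
Qed.

End Flow.

(** * Splitting by an integer-valued Lyapunov function *)

(** Compactness of the cube gives a cluster point, which for an ultrafilter is a limit. One
    ultrafilter provides limits of several sequences without successive subsequences. *)
Lemma ultra_bounded_cvg (R : realType) (n : nat) (U : set_system nat)
    (y : nat -> 'cV[R]_n) : UltraFilter U -> (forall k, `|y k| <= 1) ->
  exists z : 'cV[R]_n, y @ U --> z.
Proof.
move=> UU y1; have UP := @ultra_proper _ _ UU.
pose K := [set v : 'rV[R]_n | forall i, `[(-1 : R), 1]%classic (v ord0 i)].
have Kc : compact K.
  apply: (@rV_compact R n (fun=> `[(-1 : R), 1]%classic)) => _; exact: segment_compact.
pose F : set_system 'rV[R]_n := (fun k => (y k)^T) @ U.
have FK : F K.
  change (U [set k | K (y k)^T]); apply: filterE => k i; change ((y k)^T ord0 i \in `[(-1 : R), 1]).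
  rewrite in_itv /= mxE -ler_norml.
  exact: le_trans (mx_entry_norm _ _ _) (y1 k).
have [z [_ zF]] := Kc F _ FK; exists z^T => B /nbhs_ballP [e /= e0 eB].
have [//|hC] := in_ultra_setVsetC (y @^-1` B) UU.
have zB : nbhs z [set v : 'rV[R]_n | B v^T].
  apply/nbhs_ballP; exists e => // v [_ zv]; apply: eB; split=> // i j.
  by rewrite !mxE; exact: zv.
have FC : F [set v | ~ B v^T].
  change (U [set k | ~ B (y k)^T^T]).
  by apply: filterS hC => k; rewrite /setC /preimage /mkset trmxK.
by have [v []] := zF _ _ FC zB.
Qed.

(** A subspace of maximal dimension inside [P] absorbs every vector satisfying [P]. *)
Lemma vspace_of_pred (K : fieldType) (vT : vectType K) (P : vT -> Prop) :
  P 0 -> (forall x y, P x -> P y -> P (x + y)) ->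
  (forall (c : K) x, P x -> P (c *: x)) ->
  exists W : {vspace vT}, forall x, x \in W <-> P x.
Proof.
move=> P0 PD PZ.
pose Q (k : nat) := `[< exists2 W : {vspace vT}, (forall x, x \in W -> P x) & \dim W = k >].
have exQ : exists k, Q k.
  exists 0%N; apply/asboolP; exists 0%VS; last exact: dimv0.
  by move=> x; rewrite memv0 => /eqP ->.
have leQ k : Q k -> (k <= \dim {:vT})%N.
  by move=> /asboolP [W _ <-]; exact/dimvS/subvf.
case: (ex_maxnP exQ leQ) => k /asboolP [W WP Wk] kmax.
exists W => x; split=> [/WP //|Px].
have h : (forall y, y \in (W + <[x]>)%VS -> P y).
  by move=> _ /memv_addP [u uW [_ /vlineP [c ->] ->]]; apply: PD; [exact: WP|exact: PZ].
have : (\dim (W + <[x]>) <= \dim W)%N.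
  by rewrite Wk; apply: kmax; apply/asboolP; exists (W + <[x]>)%VS.
move=> hd; have /eqP -> : W == (W + <[x]>)%VS by rewrite eqEdim addvSl.
by apply: (subvP (addvSr _ _)); exact: memv_line.
Qed.

Lemma dimv_le_separating (K : fieldType) (n p : nat) (F : {vspace 'cV[K]_n})
    (P : 'M[K]_(p, n)) :
  (forall x, x \in F -> P *m x = 0 -> x = 0) -> (\dim F <= p)%N.
Proof.
move=> FP; pose h : 'Hom('cV[K]_n, 'cV[K]_p) := linfun (mulmx P).
have ker0 : (F :&: lker h = 0)%VS.
  apply/eqP; rewrite -subv0; apply/subvP => x.
  rewrite memv_cap memv_ker lfunE memv0 => /andP [xF /eqP /(FP _ xF) ->].
  exact: eqxx.
rewrite -(limg_dim_eq ker0) (leq_trans (dimvS (subvf _))) // dimvf.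
by rewrite (_ : dim _ = p) //; exact: muln1.
Qed.

(** The projection onto [F] is given by a matrix, hence continuous, and it fixes every [v k]. *)
Lemma vspace_limit (R : realType) (n : nat) (F : {vspace 'cV[R]_n})
    (U : set_system nat) (v : nat -> 'cV[R]_n) (z : 'cV[R]_n) :
  ProperFilter U -> v @ U --> z -> (forall k, v k \in F) -> z \in F.
Proof.
move=> UP vz vF; pose P : 'M[R]_n := \matrix_(i, j) projv F (delta_mx j 0) i 0.
have PE x : P *m x = projv F x.
  rewrite [in RHS](matrix_sum_delta x) linear_sum /=.
  apply/matrixP => i j; rewrite ord1 mxE summxE; apply: eq_bigr => l _.
  by rewrite big_ord1 linearZ /= !mxE mulrC.
suff -> : z = projv F z by exact: memv_proj.
rewrite -PE; apply/eqP; apply: contraT; rewrite -subr_eq0 -normr_gt0 => h.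
pose e := `|z - P *m z| / 2; have e0 : 0 < e by rewrite divr_gt0.
have h1 : U [set k | `|z - v k| < e] by move/cvgrPdist_lt: vz => /(_ e e0).
have h2 : U [set k | `|P *m z - P *m v k| < e].
  apply: (vz _ (@mulmx_continuous R n n 1 P z [set y | `|P *m z - y| < e] _)).
  by apply/nbhs_ballP; exists e => // y; rewrite -ball_normE.
have [k [/= k1 k2]] := filter_ex (filterI h1 h2).
have vk : P *m v k = v k by rewrite PE projv_id.
rewrite vk distrC in k2; have := ler_distD (v k) z (P *m z); rewrite -/e.
have : `|z - P *m z| = e * 2 by rewrite divfK.
lra.
Qed.

(** * Dominance and subspaces for an abstract pair of semicontinuous counts *)

Section Splitting.
Variables (R : realType) (n m : nat) (f g : 'cV[R]_n -> nat) (M : 'M[R]_n).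
Variable d : nat -> nat.
Implicit Types x y z : 'cV[R]_n.
Hypothesis fg : forall x, (f x <= g x)%N.
Hypothesis fg_near : forall x, \forall y \near x, (f x <= f y)%N /\ (g y <= g x)%N.
Hypothesis fgZ : forall (c : R) x, c != 0 -> f (c *: x) = f x /\ g (c *: x) = g x.
Hypothesis Mu : M \in unitmx.
Hypothesis gMf : forall x, x != 0 -> (g (M *m x) <= f x)%N.
Hypothesis cap : forall (F : {vspace 'cV[R]_n}) i, (i < m)%N ->
  (forall x, x \in F -> x != 0 -> f x = i /\ g x = i) -> (\dim F <= d i)%N.

Definition iter_mx k : 'M[R]_n := iter k (mulmx M) 1%:M.

Definition stays_above i x : Prop := x != 0 -> forall k, (i <= f (iter_mx k *m x))%N.

Lemma iter_mx0 x : iter_mx 0 *m x = x.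
Proof. by rewrite /iter_mx /= mul1mx. Qed.

Lemma iter_mxS k x : iter_mx k.+1 *m x = M *m (iter_mx k *m x).
Proof. by rewrite /iter_mx iterS -mulmxA. Qed.

Lemma iter_mxSr k x : iter_mx k.+1 *m x = iter_mx k *m (M *m x).
Proof. by elim: k => [|k IH]; rewrite iter_mxS ?iter_mx0 // IH -iter_mxS. Qed.

Lemma iter_mx_eq0 k x : (iter_mx k *m x == 0) = (x == 0).
Proof.
apply/eqP/eqP => [|->]; last by rewrite mulmx0.
elim: k => [|k IH]; first by rewrite iter_mx0.
rewrite iter_mxS => h; apply: IH.
by rewrite -(mulKmx Mu (iter_mx k *m x)) h mulmx0.
Qed.

Lemma g_iterS k x : x != 0 -> (g (iter_mx k.+1 *m x) <= f (iter_mx k *m x))%N.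
Proof. by move=> x0; rewrite iter_mxS gMf // iter_mx_eq0. Qed.

Lemma g_iter_le k l x : x != 0 -> (k <= l)%N ->
  (g (iter_mx l *m x) <= g (iter_mx k *m x))%N.
Proof.
move=> x0 /subnKC <-; elim: (l - k)%N => [|j IH]; first by rewrite addn0.
by rewrite addnS (leq_trans (g_iterS _ x0)) // (leq_trans (fg _)).
Qed.

Lemma not_above i x : x != 0 -> ~ stays_above i x ->
  exists k0, forall k, (k0 <= k)%N -> (g (iter_mx k *m x) < i)%N.
Proof.
move=> x0 /not_implyP [_ /existsNP [k /negP]]; rewrite -ltnNge => hk.
exists k.+1 => l kl; apply: leq_ltn_trans hk.
by apply: leq_trans (g_iterS k x0); exact: g_iter_le.
Qed.

Lemma limit_near (U : set_system nat) (v : nat -> 'cV[R]_n) z (B : 'M[R]_n) :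
  ProperFilter U -> v @ U --> z ->
  U [set k | (f (B *m z) <= f (B *m v k))%N /\ (g (B *m v k) <= g (B *m z))%N].
Proof. by move=> UP vz; exact: (vz _ (@mulmx_continuous R n n 1 B z _ (fg_near (B *m z)))). Qed.

Lemma limit_source_neq0 (U : set_system nat) (r : nat -> R) x z :
  ProperFilter U -> (fun k => r k *: (iter_mx k *m x)) @ U --> z -> z != 0 ->
  x != 0.
Proof.
move=> UP /cvgrPdist_lt /(_ `|z|) h; rewrite -normr_gt0 => /h /filter_ex [k].
by apply: contraTneq => ->; rewrite mulmx0 scaler0 subr0 ltxx.
Qed.

(** Semicontinuity bounds [g] from below at a limit, not [f]; one more application of [M] passes
    from [g (M *m z)] to [f z]. *)
Lemma limit_above (U : set_system nat) (r : nat -> R) i x z :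
  ProperFilter U -> (forall k, r k != 0) ->
  (fun k => r k *: (iter_mx k *m x)) @ U --> z -> z != 0 ->
  stays_above i x -> (i <= f z)%N.
Proof.
move=> UP r0 xz z0 xi; have x0 := limit_source_neq0 UP xz z0.
apply: leq_trans (gMf z0).
have /filter_ex [k [_]] := limit_near M UP xz.
apply: leq_trans; rewrite -scalemxAr (fgZ _ (r0 k)).2 -iter_mxS.
exact: leq_trans (xi x0 k.+1) (fg _).
Qed.

(** Dually to [limit_above], one step back with [invmx M] turns the semicontinuity of [f] into an
    upper bound for [g z]. *)
Lemma limit_below (U : set_system nat) (r : nat -> R) i x z :
  ProperFilter U -> \oo `<=` U -> (forall k, r k != 0) ->
  (fun k => r k *: (iter_mx k *m x)) @ U --> z -> z != 0 ->
  ~ stays_above i x -> (g z < i)%N.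
Proof.
move=> UP Uoo r0 xz z0 xi; have x0 := limit_source_neq0 UP xz z0.
have [k0 hk0] := not_above x0 xi.
pose y := invmx M *m z; have yz : M *m y = z by rewrite /y mulKVmx.
have y0 : y != 0 by apply: contra z0 => /eqP y0; rewrite -yz y0 mulmx0.
rewrite -yz; apply: leq_ltn_trans (gMf y0) _.
have hU := limit_near (invmx M) UP xz; rewrite -/y in hU.
have [k [kk [hk _]]] := filter_ex (filterI (Uoo _ (nbhs_infty_ge k0.+1)) hU).
apply: leq_ltn_trans hk _; case: k kk => // k kk.
rewrite -scalemxAr (fgZ _ (r0 _)).1 iter_mxS mulKmx //.
by apply: leq_ltn_trans (fg _) _; exact: hk0.
Qed.

(** The two alternatives are open and, as [f <= g], disjoint; a segment is connected. *)
Lemma segment_dichotomy i z v : (forall b : R, 0 <= b <= 1 ->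
    (i <= f (z + b *: v))%N \/ (g (z + b *: v) < i)%N) ->
  (i <= f z)%N -> (i <= f (z + v))%N.
Proof.
move=> h hz; rewrite leqNgt; apply/negP => hv.
have wnear b (P : set 'cV[R]_n) : nbhs (z + b *: v) P ->
    exists2 e : R, 0 < e & forall c, `|b - c| < e -> P (z + c *: v).
  move=> /nbhs_ballP [e /= e0 eP]; have v1 : 0 < `|v| + 1 by rewrite ltr_wpDl.
  exists (e / (`|v| + 1)); first by rewrite divr_gt0.
  move=> c; rewrite ltr_pdivlMr // => bc; apply: eP; rewrite -ball_normE /=.
  have -> : z + b *: v - (z + c *: v) = (b - c) *: v.
    by rewrite opprD addrACA subrr add0r scalerBl.
  by rewrite normrZ (le_lt_trans _ bc) // ler_wpM2l // lerDl.
pose B := [set b : R | 0 <= b <= 1 /\ (i <= f (z + b *: v))%N].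
have B0 : B 0 by split; rewrite ?scale0r ?addr0 // lexx ler01.
have Bsup : has_sup B by split; [exists 0|exists 1 => b [/andP []]].
pose t := sup B.
have t0 : 0 <= t by apply: ub_le_sup B0; case: Bsup.
have t1 : t <= 1 by apply: ge_sup; [exists 0|move=> b [/andP []]].
have [ht|ht] := h t (introT andP (conj t0 t1)).
  have [e e0 he] := wnear _ _ (fg_near (z + t *: v)).
  have tlt : t < 1.
    rewrite lt_neqAle t1 andbT; apply/eqP => tE.
    by move: ht; rewrite tE scale1r leqNgt hv.
  pose c := Num.min 1 (t + e / 2).
  have tc : t < c by rewrite lt_min tlt /=; lra.
  have : B c.
    split; first by rewrite ge_min lexx (le_trans t0 (ltW tc)).
    apply: leq_trans ht (he _ _).1.
    have : c <= t + e / 2 by rewrite ge_min lexx orbT.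
    by rewrite ltr_norml => ?; apply/andP; split; lra.
  by move=> /(ub_le_sup Bsup.2); rewrite -/t leNgt tc.
have [e e0 he] := wnear _ _ (fg_near (z + t *: v)).
have [b Bb bt] := sup_adherent e0 Bsup.
have bt' : b <= t by apply: ub_le_sup Bb; case: Bsup.
have tb : `|t - b| < e.
  by move: bt; rewrite -/t => bt; rewrite ltr_norml; apply/andP; split; lra.
have [_ hb] := Bb; have [_] := he b tb.
move=> hgb; have := leq_ltn_trans hgb ht.
by rewrite ltnNge (leq_trans hb (fg _)).
Qed.

(** Otherwise [x' + c *: x] with small [c] would still fall below [i], while its rescaled limit
    [c *: z] is that of a vector staying above [i]. *)
Lemma no_degenerate_perturbation (U : set_system nat) (r : nat -> R) i x x' z :
  ProperFilter U -> \oo `<=` U -> (forall k, r k != 0) ->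
  (fun k => r k *: (iter_mx k *m x)) @ U --> z -> z != 0 -> stays_above i x ->
  (fun k => r k *: (iter_mx k *m x')) @ U --> (0 : 'cV[R]_n) ->
  stays_above i x'.
Proof.
move=> UP Uoo r0 xz z0 xi x'z; apply: contrapT => nx'.
have x'0 : x' != 0 by apply/eqP => h; apply: nx'; rewrite /stays_above h eqxx.
have [k0 hk0] := not_above x'0 nx'.
have hlt := hk0 k0 (leqnn _).
have /nbhs_ballP [e /= e0 he] := fg_near (iter_mx k0 *m x').
pose v := iter_mx k0 *m x.
have v1 : 0 < `|v| + 1 by rewrite ltr_wpDl.
pose c := e / (`|v| + 1); have c0 : 0 < c by rewrite divr_gt0.
have cn0 : c != 0 by rewrite gt_eqF.
have lim : (fun k => r k *: (iter_mx k *m (x' + c *: x))) @ U --> 0 + c *: z.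
  have E k : r k *: (iter_mx k *m (x' + c *: x)) =
      r k *: (iter_mx k *m x') + c *: (r k *: (iter_mx k *m x)).
    by rewrite mulmxDr scalerDr -scalemxAr !scalerA (mulrC c).
  under eq_fun do rewrite E.
  by apply: cvgD => //; apply: cvgZr.
have cz0 : 0 + c *: z != 0 by rewrite add0r scaler_eq0 negb_or cn0.
have [|nabove] := pselect (stays_above i (x' + c *: x)).
  have y0 := limit_source_neq0 UP lim cz0.
  move=> /(_ y0 k0); rewrite leqNgt => /negP; apply.
  apply: leq_ltn_trans (fg _) _; apply: leq_ltn_trans (he _ _).2 hlt.
  rewrite -ball_normE /= mulmxDr opprD addrA subrr sub0r normrN -scalemxAr.
  rewrite normrZ gtr0_norm // -/v /c mulrAC ltr_pdivrMr //.
  by rewrite ltr_pM2l // ltrDl.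
have := limit_below UP Uoo r0 lim cz0 nabove; rewrite add0r (fgZ _ cn0).2.
by rewrite ltnNge (leq_trans (limit_above UP r0 xz z0 xi) (fg _)).
Qed.

Lemma dominance i x x' (e : R) : stays_above i x -> ~ stays_above i x' -> 0 < e ->
  \forall k \near \oo, `|iter_mx k *m x| <= e * `|iter_mx k *m x'|.
Proof.
move=> xi nx' e0; apply: contrapT => nnear.
have x'0 : x' != 0 by apply/eqP => h; apply: nx'; rewrite /stays_above h eqxx.
(* If the estimate fails, it does so at infinitely many times; the ultrafilter is concentrated on
   them. *)
pose E := [set k | e * `|iter_mx k *m x'| <= `|iter_mx k *m x|].
have GP : ProperFilter (within E \oo).
  apply: Build_ProperFilter => h; apply: nnear.
  have {}h : \forall k \near \oo, ~ E k by exact: h.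
  by apply: filterS h => k hk; rewrite leNgt; apply/negP => /ltW /hk.
have [U [UU GU]] := ultraFilterLemma GP.
have UP := @ultra_proper _ _ UU.
have Uoo : \oo `<=` U.
  by move=> P hP; apply: GU; apply: filterS hP => k Pk _.
have UE : U E.
  by apply: GU; have : \forall k \near \oo, E k -> E k by apply: nearW.
(* A common scale keeps both rescaled orbits bounded and allows them to be combined linearly. *)
pose w k := Num.max `|iter_mx k *m x| `|iter_mx k *m x'|.
have w0 k : 0 < w k by rewrite lt_max orbC normr_gt0 iter_mx_eq0 x'0.
pose r k := (w k)^-1.
have r0 k : r k != 0 by rewrite invr_eq0 gt_eqF.
have rn y k : `|r k *: (iter_mx k *m y)| = `|iter_mx k *m y| / w k.
  by rewrite normrZ gtr0_norm ?invr_gt0 // mulrC.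
have [z xz] : exists z : 'cV[R]_n, (fun k => r k *: (iter_mx k *m x)) @ U --> z.
  apply: ultra_bounded_cvg => k; rewrite rn ler_pdivrMr // mul1r.
  by rewrite le_max lexx.
have [z' xz'] : exists z : 'cV[R]_n, (fun k => r k *: (iter_mx k *m x')) @ U --> z.
  apply: ultra_bounded_cvg => k; rewrite rn ler_pdivrMr // mul1r.
  by rewrite le_max lexx orbT.
have z0 : z != 0.
  apply/eqP => zE; rewrite zE in xz.
  pose q := Num.min 1 e.
  have q0 : 0 < q by rewrite lt_min ltr01.
  move/cvgrPdist_lt: xz => /(_ q q0) hk.
  have [k [Ek]] := filter_ex (filterI UE hk).
  rewrite /= sub0r normrN rn ltr_pdivrMr // /w ltNge; apply/negP/negPn.
  have q1 : q <= 1 by rewrite ge_min lexx.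
  have qe : q <= e by rewrite ge_min lexx orbT.
  rewrite /Num.max; case: ifP => _; last by rewrite ler_piMl.
  by apply: le_trans Ek; rewrite ler_wpM2r.
have [z'0|z'0] := eqVneq z' 0.
  by apply: nx'; rewrite z'0 in xz'; exact: no_degenerate_perturbation xz z0 xi xz'.
have fz := limit_above UP r0 xz z0 xi.
have gz' := limit_below UP Uoo r0 xz' z'0 nx'.
have : (i <= f (z + (z' - z)))%N.
  apply: segment_dichotomy (fz) => b /andP [b0 b1].
  have lim : (fun k => r k *: (iter_mx k *m (x + b *: (x' - x)))) @ U -->
      z + b *: (z' - z).
    have Eb k : r k *: (iter_mx k *m (x + b *: (x' - x))) = r k *: (iter_mx k *m x)
        + b *: (r k *: (iter_mx k *m x') - r k *: (iter_mx k *m x)).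
      by rewrite mulmxDr scalerDr -scalemxAr mulmxBr -scalerBr !scalerA (mulrC b).
    under eq_fun do rewrite Eb.
    by apply: cvgD => //; apply: cvgZr; apply: cvgB.
  (* If the segment met 0, [z] and [z'] would be proportional, against [g z' < i <= f z]. *)
  have lim0 : z + b *: (z' - z) != 0.
    apply/eqP => h.
    have h2 : (1 - b) *: z = (- b) *: z'.
      apply/eqP; rewrite -subr_eq0 -[X in _ == X]h; apply/eqP.
      by apply/matrixP => k l; rewrite !mxE; ring.
    have b0' : b != 0.
      by apply/eqP => bE; move: h; rewrite bE scale0r addr0; apply/eqP.
    have b1' : 1 - b != 0.
      apply/eqP => bE; move/eqP: h2; rewrite bE scale0r eq_sym scaler_eq0.
      by rewrite oppr_eq0 (negbTE b0') (negbTE z'0).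
    have nb0 : - b != 0 by rewrite oppr_eq0.
    move: fz; rewrite -(fgZ z b1').1 h2 (fgZ z' nb0).1 leqNgt => /negP; apply.
    exact: leq_ltn_trans (fg _) gz'.
  have [ha|ha] := pselect (stays_above i (x + b *: (x' - x))).
    by left; exact: limit_above lim lim0 ha.
  by right; exact: limit_below lim lim0 ha.
rewrite addrC subrK leqNgt => /negP; apply; exact: leq_ltn_trans (fg _) gz'.
Qed.

Lemma stays_above0 i : stays_above i 0.
Proof. by rewrite /stays_above eqxx. Qed.

Lemma stays_aboveZ i (c : R) x : stays_above i x -> stays_above i (c *: x).
Proof.
have [->|c0] := eqVneq c 0; first by rewrite scale0r => _; exact: stays_above0.
move=> xi; rewrite /stays_above scaler_eq0 (negbTE c0) /= => x0 k.
by rewrite -scalemxAr (fgZ _ c0).1; exact: xi.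
Qed.

(** Otherwise [x] and [y] would both be dominated by [x + y] with factor 1/3, against the triangle
    inequality. *)
Lemma stays_aboveD i x y : stays_above i x -> stays_above i y ->
  stays_above i (x + y).
Proof.
move=> xi yi; apply: contrapT => nxy.
have xy0 : x + y != 0 by apply/eqP => h; apply: nxy; rewrite h; exact: stays_above0.
have e0 : 0 < 3^-1 :> R by rewrite invr_gt0.
have hx := dominance xi nxy e0; have hy := dominance yi nxy e0.
have [k [h1 h2]] := filter_ex (filterI hx hy).
have := ler_normD (iter_mx k *m x) (iter_mx k *m y); rewrite -mulmxDr.
have : 0 < `|iter_mx k *m (x + y)| by rewrite normr_gt0 iter_mx_eq0.
lra.
Qed.

(** Unit vectors that violate the bound at ever later times have a limit in [F]. That limit falls
    below [i] at some time, and so do the vectors near it, for good. *)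
Lemma uniform_below i (F : {vspace 'cV[R]_n}) :
  (forall x, x \in F -> x != 0 -> ~ stays_above i x) ->
  exists k, forall x, x \in F -> x != 0 -> (g (iter_mx k *m x) < i)%N.
Proof.
move=> Fi; apply: contrapT => nk.
have bad k : exists x, [/\ x \in F, `|x| = 1 & (i <= g (iter_mx k *m x))%N].
  apply: contrapT => hx; apply: nk; exists k => x xF x0.
  rewrite ltnNge; apply/negP => hg; apply: hx; exists (`|x|^-1 *: x).
  have nx : `|x|^-1 != 0 by rewrite invr_eq0 normr_eq0.
  split; first exact: memvZ.
    by rewrite normrZ ger0_norm ?invr_ge0 // mulVf // normr_eq0.
  by rewrite -scalemxAr (fgZ _ nx).2.
have /choice [v hv] := bad.
have [U [UU Uoo]] := ultraFilterLemma eventually_filter.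
have UP := @ultra_proper _ _ UU.
have [z vz] : exists z, v @ U --> z.
  by apply: ultra_bounded_cvg => k; have [_ -> _] := hv k.
have zF : z \in F by apply: vspace_limit vz _ => k; have [] := hv k.
have z0 : z != 0.
  apply/eqP => zE; rewrite zE in vz; move/cvgrPdist_lt: vz => /(_ 1 ltr01).
  move=> h; have [k] := filter_ex h; have [_ v1 _] := hv k.
  by rewrite sub0r normrN v1 ltxx.
have [k0 hk0] := not_above z0 (Fi _ zF z0).
have hU := limit_near (iter_mx k0) UP vz.
have [k [kk [_ hk]]] := filter_ex (filterI (Uoo _ (nbhs_infty_ge k0)) hU).
have [_ v1 hg] := hv k.
have vk0 : v k != 0 by rewrite -normr_eq0 v1 oner_eq0.
have := leq_ltn_trans hk (hk0 _ (leqnn _)).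
by rewrite ltnNge (leq_trans hg) // g_iter_le.
Qed.

Lemma stays_above_vspaces : exists V : nat -> {vspace 'cV[R]_n},
  (forall i x, x \in V i <-> stays_above i x) /\
  (forall i, (i <= m)%N -> (n <= \dim (V i) + \sum_(j < i) d j)%N).
Proof.
have /choice [V VP] : forall i, exists W : {vspace 'cV[R]_n},
    forall x, x \in W <-> stays_above i x.
  move=> i; apply: vspace_of_pred; [exact: stays_above0| |].
    by move=> x y; exact: stays_aboveD.
  by move=> c x; exact: stays_aboveZ.
exists V; split=> // i; elim: i => [_|i IH im].
  rewrite big_ord0 addn0 (_ : V 0%N = fullv); first by rewrite dimvf (_ : dim _ = n) //; exact: muln1.
  by apply/vspaceP => x; rewrite memvf; apply/idP/VP => //.
apply: leq_trans (IH (ltnW im)) _; rewrite big_ord_recr /= addnC addnCA leq_add2l.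
rewrite -(dimv_cap_compl (V i) (V i.+1)) leq_add //.
  by apply: dimvS; exact: capvSr.
pose F := (V i :\: V i.+1)%VS.
have FV x : x \in F -> stays_above i x.
  by move=> xF; apply/VP; exact: (subvP (diffvSl _ _)) xF.
have FnV x : x \in F -> x != 0 -> ~ stays_above i.+1 x.
  move=> xF x0 /VP xV; have : x \in (F :&: V i.+1)%VS by rewrite memv_cap xF.
  by rewrite capv_diff memv0 (negbTE x0).
(* On the complement [F] all iterates have [f >= i], and the [k]-th has [g <= i]; hence [cap]
   applies to the image of [F], which has the same dimension. *)
have [k hk] := uniform_below FnV.
pose h : 'Hom('cV[R]_n, 'cV[R]_n) := linfun (mulmx (iter_mx k)).
have ker0 : (F :&: lker h = 0)%VS.
  apply/eqP; rewrite -subv0; apply/subvP => x.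
  by rewrite memv_cap memv_ker lfunE /= iter_mx_eq0 memv0 => /andP [].
rewrite -/F -(limg_dim_eq ker0); apply: cap => // _ /memv_imgP [x xF ->].
rewrite lfunE /= iter_mx_eq0 => x0.
have h1 := hk x xF x0; have h2 := FV x xF x0 k; have h3 := fg (iter_mx k *m x).
rewrite ltnS in h1; split; apply/eqP; rewrite eqn_leq.
  by rewrite (leq_trans h3 h1) h2.
by rewrite h1 (leq_trans h2 h3).
Qed.

End Splitting.

(* The lower half of the splitting is the upper half for the inverse matrix,
   with the values of f and g reflected in 0, ..., m - 1. *)
Lemma invariant_splitting (R : realType) (n m : nat) (f g : 'cV[R]_n -> nat)
    (M : 'M[R]_n) (d : nat -> nat) :
  (forall x, (f x <= g x)%N) -> (forall x, (g x < m)%N) ->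
  (forall x, \forall y \near x, (f x <= f y)%N /\ (g y <= g x)%N) ->
  (forall (c : R) x, c != 0 -> f (c *: x) = f x /\ g (c *: x) = g x) ->
  M \in unitmx -> (forall x, x != 0 -> (g (M *m x) <= f x)%N) ->
  (forall (F : {vspace 'cV[R]_n}) i, (i < m)%N ->
    (forall x, x \in F -> x != 0 -> f x = i /\ g x = i) -> (\dim F <= d i)%N) ->
  (\sum_(i < m) d i)%N = n ->
  exists W : nat -> {vspace 'cV[R]_n},
    [/\ forall i x, (i < m)%N -> x \in W i -> M *m x \in W i,
        forall i, (i < m)%N -> \dim (W i) = d i,
        (\sum_(i < m) W i)%VS = fullv /\ directv (\sum_(i < m) W i),
        forall i k x, (i <= k < m)%N ->
          x \in (\sum_(j < m | (i <= j <= k)%N) W j)%VS -> x != 0 ->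
          (i <= f x)%N /\ (g x <= k)%N &
        forall i x x' (e : R), (i.+1 < m)%N -> x \in W i.+1 -> x' \in W i ->
          x' != 0 -> 0 < e ->
          \forall k \near \oo, `|iter_mx M k *m x| <= e * `|iter_mx M k *m x'|].
Proof.
move=> fg gm near_fg Zfg Mu gMf cap dn.
(* Reflection exchanges the counts: the lower one [f'] comes from [g]. *)
pose f' x := (m.-1 - g x)%N; pose g' x := (m.-1 - f x)%N.
pose d' i := d (m.-1 - i)%N.
have gm1 x : (g x <= m.-1)%N by have := gm x; case: (m).
have fm1 x : (f x <= m.-1)%N by exact: leq_trans (fg x) (gm1 x).
have m0 : (0 < m)%N by exact: leq_ltn_trans (gm 0).
have fg' x : (f' x <= g' x)%N by exact: leq_sub2l.
have gm' x : (g' x < m)%N by rewrite /g' -[X in (_ < X)%N](prednK m0) ltnS leq_subr.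
have near' x : \forall y \near x, (f' x <= f' y)%N /\ (g' y <= g' x)%N.
  by apply: filterS (near_fg x) => y [h1 h2]; split; exact: leq_sub2l.
have Z' (c : R) x : c != 0 -> f' (c *: x) = f' x /\ g' (c *: x) = g' x.
  by move=> c0; rewrite /f' /g' !(Zfg c x c0).1 !(Zfg c x c0).2.
have Mu' : invmx M \in unitmx by rewrite unitmx_inv.
have gMf' x : x != 0 -> (g' (invmx M *m x) <= f' x)%N.
  move=> x0; apply: leq_sub2l; rewrite -[in leqLHS](mulKVmx Mu x); apply: gMf.
  by apply: contra x0 => /eqP h; rewrite -[x](mulKVmx Mu) h mulmx0.
have cap' (F : {vspace 'cV[R]_n}) i : (i < m)%N ->
    (forall x, x \in F -> x != 0 -> f' x = i /\ g' x = i) -> (\dim F <= d' i)%N.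
  move=> im hF; apply: cap => [|x xF x0].
    by rewrite -[X in (_ < X)%N](prednK m0) ltnS leq_subr.
  have [h1 h2] := hF x xF x0; split; first by rewrite -h2 /g' subKn.
  by rewrite -h1 /f' subKn.
have [V [VP Vdim]] := stays_above_vspaces fg near_fg Zfg Mu gMf cap.
have [V' [V'P V'dim]] := stays_above_vspaces fg' near' Z' Mu' gMf' cap'.
pose U i := V' (m.-1 - i)%N; pose W i := (V i :&: U i)%VS.
have Vf i x : x \in V i -> x != 0 -> (i <= f x)%N.
  by move=> /VP h x0; have := h x0 0%N; rewrite iter_mx0.
have Ug i x : (i < m)%N -> x \in U i -> x != 0 -> (g x <= i)%N.
  move=> im /V'P h x0; have := h x0 0%N; rewrite iter_mx0 /f'.
  by rewrite leq_sub2lE // -ltnS prednK.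
have VM i x : x \in V i -> M *m x \in V i.
  move=> /VP h; apply/VP => Mx0 k; rewrite -iter_mxSr; apply: h.
  by apply: contra Mx0 => /eqP ->; rewrite mulmx0.
have UM i x : (i < m)%N -> x \in U i -> M *m x \in U i.
  move=> im xU; apply/V'P => Mx0 k.
  have x0 : x != 0 by apply: contra Mx0 => /eqP ->; rewrite mulmx0.
  (* Later iterates of the inverse return to the orbit of [x]; only the point [M *m x] itself needs
     the monotonicity of the counts. *)
  case: k => [|k]; last by rewrite iter_mxSr mulKmx //; move/V'P: xU; apply.
  rewrite iter_mx0 /f' leq_sub2l // (leq_trans (gMf x x0)) //.
  exact: leq_trans (fg x) (Ug i x im xU x0).
have Vsub i j : (i <= j)%N -> (V j <= V i)%VS.
  by move=> ij; apply/subvP => x /VP h; apply/VP => x0 k; exact: leq_trans ij (h x0 k).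
have Usub i j : (i <= j)%N -> (U i <= U j)%VS.
  move=> ij; apply/subvP => x /V'P h; apply/V'P => x0 k.
  by apply: leq_trans (h x0 k); exact: leq_sub2l.
have sumd i : (i < m)%N ->
    (\sum_(j < i) d j + d i + \sum_(j < m.-1 - i) d' j)%N = n.
  move=> im; have E : m = (i.+1 + (m.-1 - i))%N by lia.
  rewrite -[RHS]dn [in RHS]E big_split_ord /= big_ord_recr /=; congr (_ + _)%N.
  rewrite (reindex_inj rev_ord_inj); apply: eq_bigr => j _; rewrite /d' /=.
  by congr d; have := ltn_ord j; lia.
have Wfg i x : (i < m)%N -> x \in W i -> x != 0 -> f x = i /\ g x = i.
  rewrite memv_cap => im /andP [/Vf hV /(Ug _ _ im) hU] x0.
  by have := hV x0; have := hU x0; have := fg x; lia.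
(* The codimension of [V i] is at most the sum of the [d j] below [i], that of [U i] at most the sum
   above, so the intersection has dimension at least [d i]; [cap] gives the converse. *)
have Wdim i : (i < m)%N -> \dim (W i) = d i.
  move=> im; apply/eqP; rewrite eqn_leq cap //=; last by move=> x; exact: Wfg.
  have h1 := Vdim i (ltnW im).
  have h2 : (n <= \dim (U i) + \sum_(j < m.-1 - i) d' j)%N.
    by apply: V'dim; lia.
  have h3 : (\dim (V i + U i) <= n)%N.
    by rewrite (leq_trans (dimvS (subvf _))) // dimvf (_ : dim _ = n) //; exact: muln1.
  have := dimv_sum_cap (V i) (U i); have := sumd i im.
  rewrite -/(W i); lia.
(* The blocks before a positive [k] lie in [U k.-1], where [g < k] off 0, so their sum meets [W k]
   only in 0. *)
have Wpart k : (k <= m)%N -> \dim (\sum_(j < k) W j)%VS = (\sum_(j < k) d j)%N.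
  elim: k => [_|k IH km]; first by rewrite !big_ord0 dimv0.
  rewrite !big_ord_recr /= dimv_disjoint_sum ?IH ?Wdim // 1?ltnW //.
  apply/eqP; rewrite -subv0; apply/subvP => x; rewrite memv_cap memv0 => /andP [xS xW].
  apply: contraT => x0; case: k {IH} km xS xW => [|k] km.
    by rewrite big_ord0 memv0 (negbTE x0).
  move=> xS /(Wfg _ _ km) /(_ x0) [_ gx].
  have : x \in U k.
    apply: (subvP _ _ xS); apply/subv_sumP => j _.
    by rewrite (subv_trans (capvSr _ _)) // Usub // -ltnS.
  by move=> /(Ug _ _ (ltnW km)) /(_ x0); rewrite gx ltnn.
exists W; split.
- by move=> i x im; rewrite !memv_cap => /andP [xV xU]; rewrite VM ?UM.
- exact: Wdim.
- split.
    apply/eqP; rewrite eqEdim subvf /= Wpart // dn dimvf (_ : dim _ = n) //.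
    exact: muln1.
  by rewrite directvE /= Wpart //; apply/eqP; apply: eq_bigr => i _; rewrite Wdim.
- move=> i k x /andP [ik km] xS x0; split.
    apply: Vf x0; apply: (subvP _ _ xS); apply/subv_sumP => j /andP [ij _].
    by rewrite (subv_trans (capvSl _ _)) // Vsub.
  apply: Ug x0 => //; apply: (subvP _ _ xS); apply/subv_sumP => j /andP [_ jk].
  by rewrite (subv_trans (capvSr _ _)) // Usub.
move=> i x x' e im xW x'W x'0 e0.
apply: (@dominance _ _ f g M fg near_fg Zfg Mu gMf i.+1) => //.
  by apply/VP; move: xW; rewrite memv_cap => /andP [].
move=> /(_ x'0 0%N); rewrite iter_mx0.
by have [-> _] := Wfg _ _ (ltnW im) x'W x'0; rewrite ltnn.
Qed.

(** * Eigenvalue moduli *)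

Section ComplexEigenvalues.
Variables (R : realType).
Local Notation C := R[i].
Local Notation reM := (map_mx (@complex.Re R)).
Local Notation imM := (map_mx (@complex.Im R)).
Local Notation toC := (map_mx (real_complex R)).

Lemma normc_Re (z : C) : `|complex.Re z| <= Normc.normc z.
Proof. by case: z => a b /=; rewrite -sqrtr_sqr ler_sqrt ?addr_ge0 ?sqr_ge0 // lerDl sqr_ge0. Qed.

Lemma normc_Im (z : C) : `|complex.Im z| <= Normc.normc z.
Proof. by case: z => a b /=; rewrite -sqrtr_sqr ler_sqrt ?addr_ge0 ?sqr_ge0 // lerDr sqr_ge0. Qed.

Lemma normcX (z : C) k : Normc.normc (z ^+ k) = Normc.normc z ^+ k.
Proof.
elim: k => [|k IH]; first by rewrite !expr0 Normc.normc1.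
by rewrite !exprS Normc.normcM IH.
Qed.

Lemma normc_ge0 (z : C) : 0 <= Normc.normc z.
Proof. by case: z => a b; exact: sqrtr_ge0. Qed.

Lemma reM_mul (m n p : nat) (B : 'M[R]_(m, n)) (v : 'M[C]_(n, p)) :
  reM (toC B *m v) = B *m reM v.
Proof.
have ReD (x y : C) : complex.Re (x + y) = complex.Re x + complex.Re y.
  by case: x y => [a b] [c e].
apply/matrixP => i j; rewrite !mxE (big_morph _ ReD (erefl (complex.Re (0 : C)))).
by apply: eq_bigr => k _; rewrite !mxE; case: (v k j) => a b /=; rewrite mul0r subr0.
Qed.

Lemma imM_mul (m n p : nat) (B : 'M[R]_(m, n)) (v : 'M[C]_(n, p)) :
  imM (toC B *m v) = B *m imM v.
Proof.
have ImD (x y : C) : complex.Im (x + y) = complex.Im x + complex.Im y.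
  by case: x y => [a b] [c e].
apply/matrixP => i j; rewrite !mxE (big_morph _ ImD (erefl (complex.Im (0 : C)))).
by apply: eq_bigr => k _; rewrite !mxE; case: (v k j) => a b /=; rewrite mul0r addr0.
Qed.

Lemma reM_scale (n p : nat) (z : C) (v : 'M[C]_(n, p)) :
  reM (z *: v) = complex.Re z *: reM v - complex.Im z *: imM v.
Proof. by apply/matrixP => i j; rewrite !mxE; case: z (v i j) => [a b] [c e]. Qed.

Lemma imM_scale (n p : nat) (z : C) (v : 'M[C]_(n, p)) :
  imM (z *: v) = complex.Re z *: imM v + complex.Im z *: reM v.
Proof. by apply/matrixP => i j; rewrite !mxE; case: z (v i j) => [a b] [c e]. Qed.

Lemma reim_eq0 (n p : nat) (v : 'M[C]_(n, p)) : reM v = 0 -> imM v = 0 -> v = 0.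
Proof.
move=> /matrixP hr /matrixP hi; apply/matrixP => i j.
have := hr i j; have := hi i j; rewrite !mxE.
by case: (v i j) => a b /= -> ->.
Qed.

(** Multiplication by [z] scales this quantity by the modulus of [z] only up to a factor 2 either
    way, which is harmless for comparing growth rates. *)
Definition cnorm (n : nat) (v : 'cV[C]_n) : R := `|reM v| + `|imM v|.

Lemma cnorm_gt0 (n : nat) (v : 'cV[C]_n) : v != 0 -> 0 < cnorm v.
Proof.
move=> v0; rewrite lt_neqAle addr_ge0 // andbT eq_sym paddr_eq0 // !normr_eq0.
by apply: contra v0 => /andP [/eqP h1 /eqP h2]; rewrite (reim_eq0 h1 h2).
Qed.

Lemma cnormZ_le (n : nat) (z : C) (v : 'cV[C]_n) :
  cnorm (z *: v) <= 2 * Normc.normc z * cnorm v.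
Proof.
rewrite /cnorm reM_scale imM_scale.
have := ler_normB (complex.Re z *: reM v) (complex.Im z *: imM v).
have := ler_normD (complex.Re z *: imM v) (complex.Im z *: reM v).
rewrite !normrZ.
have := ler_wpM2r (normr_ge0 (reM v)) (normc_Re z).
have := ler_wpM2r (normr_ge0 (imM v)) (normc_Re z).
have := ler_wpM2r (normr_ge0 (reM v)) (normc_Im z).
have := ler_wpM2r (normr_ge0 (imM v)) (normc_Im z).
lra.
Qed.

Lemma cnormZ_ge (n : nat) (z : C) (v : 'cV[C]_n) : z != 0 ->
  Normc.normc z * cnorm v <= 2 * cnorm (z *: v).
Proof.
move=> z0; have nz : 0 < Normc.normc z.
  rewrite lt_neqAle normc_ge0 andbT eq_sym.
  by apply: contra z0 => /eqP /Normc.eq0_normc ->.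
have := cnormZ_le z^-1 (z *: v); rewrite scalerA mulVf // scale1r Normc.normcV.
by rewrite mulrAC ler_pdivlMr // mulrC.
Qed.

Lemma eigen_iter (n : nat) (M : 'M[R]_n) (z : C) (v : 'cV[C]_n) k :
  toC M *m v = z *: v -> toC (iter_mx M k) *m v = z ^+ k *: v.
Proof.
move=> h; elim: k => [|k IH].
  by rewrite /iter_mx /= map_mx1 mul1mx expr0 scale1r.
rewrite (_ : iter_mx M k.+1 = M *m iter_mx M k) // map_mxM -mulmxA IH.
by rewrite -scalemxAr h scalerA exprSr.
Qed.

(** The matrix [A] of the restriction in the basis [X] has a complex eigenvector, which the
    injective [B] carries into the complexification of [W]. The transposes appear because
    [eigenvalueP] concerns row vectors. *)
Lemma restr_eigenvalue_exists (n : nat) (M : 'M[R]_n) (W : {vspace 'cV[R]_n}) :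
  invariant_subspace M W -> (0 < \dim W)%N -> exists z, restr_eigenvalue M W z.
Proof.
move=> MW W0; pose X := vbasis W; pose r := \dim W.
pose B : 'M[R]_(n, r) := \matrix_(i, j) X`_j i 0.
pose A : 'M[R]_r := \matrix_(i, j) coord X i (M *m X`_j).
have XW (j : 'I_r) : X`_j \in W.
  by apply: vbasis_mem; rewrite mem_nth // size_tuple.
have BE (c : 'cV[R]_r) : B *m c = \sum_j c j 0 *: X`_j.
  apply/matrixP => i k; rewrite ord1 mxE summxE; apply: eq_bigr => j _.
  by rewrite !mxE mulrC.
have BW (c : 'cV[R]_r) : B *m c \in W.
  by rewrite BE; apply: memv_suml => j _; apply: memvZ.
have MB : M *m B = B *m A.
  apply/matrixP => i j; have := coord_vbasis (MW _ (XW j)) => /matrixP /(_ i 0).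
  rewrite summxE => h; rewrite [RHS]mxE.
  rewrite (_ : (M *m B) i j = (M *m X`_j) i 0); last first.
    by rewrite !mxE; apply: eq_bigr => k _; rewrite !mxE.
  by rewrite h; apply: eq_bigr => k _; rewrite !mxE mulrC.
have [z /eigenvalueP [c hc c0]] := eigenvalue_closed (toC A)^T W0.
have hcT : toC A *m c^T = z *: c^T.
  by rewrite -[toC A]trmxK -trmx_mul hc linearZ.
exists z, (toC B *m c^T); split.
- apply: contra c0 => /eqP h; apply/eqP; rewrite -[c]trmxK; apply/eqP.
  rewrite trmx_eq0; apply/eqP.
  have inj (e : 'cV[R]_r) : B *m e = 0 -> e = 0.
    rewrite BE => he; apply/matrixP => j k; rewrite ord1 mxE.
    have fX : free (vbasis W) := basis_free (vbasisP W).
    by have /freeP /(_ (fun j => e j 0) he j) := fX.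
  by apply: reim_eq0; apply: inj; rewrite -?reM_mul -?imM_mul h;
    apply/matrixP => i j; rewrite !mxE.
- by rewrite reM_mul.
- by rewrite imM_mul.
by rewrite mulmxA -map_mxM MB map_mxM -mulmxA hcT scalemxAr.
Qed.

Lemma restr_eigenvalue_finite (n : nat) (M : 'M[R]_n) (W : {vspace 'cV[R]_n}) :
  exists rs : seq C, forall z, restr_eigenvalue M W z -> z \in rs.
Proof.
have [rs hrs] := closed_field_poly_normal (char_poly (toC M)^T).
exists rs => z [v [v0 _ _ hv]].
have : eigenvalue (toC M)^T z.
  apply/eigenvalueP; exists v^T; last by rewrite trmx_eq0.
  by rewrite -trmx_mul hv linearZ.
rewrite eigenvalue_root_char hrs (monicP (char_poly_monic _)) scale1r.
by rewrite root_prod_XsubC.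
Qed.

Lemma finite_extrema (T : Type) (F : T -> R) (X : set T) (rs : seq T) :
  (forall z, X z -> List.In z rs) -> X !=set0 ->
  (exists m, is_minimum [set F z | z in X] m) /\
  (exists m, is_maximum [set F z | z in X] m).
Proof.
elim: rs X => [|a rs IH] X hX [x Xx]; first by have := hX x Xx.
have [[y Yy]|hY] := pselect (([set z | X z /\ List.In z rs]) !=set0); last first.
  have all_a z : X z -> z = a.
    move=> Xz; case: (hX z Xz) => // hz.
    by exfalso; apply: hY; exists z.
  split; exists (F x); split; try by exists x.
    by move=> _ [z Xz <-]; rewrite (all_a z Xz) (all_a x Xx).
  by move=> _ [z Xz <-]; rewrite (all_a z Xz) (all_a x Xx).
have [|[m1 [[z1 [X1 _] <-] h1]] [m2 [[z2 [X2 _] <-] h2]]] :=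
    IH [set z | X z /\ List.In z rs] _ (ex_intro _ y Yy); first by move=> z [].
have [Xa|nXa] := pselect (X a); last first.
  have sub z : X z -> X z /\ List.In z rs.
    by move=> Xz; split=> //; case: (hX z Xz) => // E; rewrite -E in Xz.
  split; [exists (F z1)|exists (F z2)]; split; try by [exists z1|exists z2].
    by move=> _ [z Xz <-]; apply: h1; exists z => //; exact: sub.
  by move=> _ [z Xz <-]; apply: h2; exists z => //; exact: sub.
split.
  have [le|lt] := leP (F a) (F z1); [exists (F a)|exists (F z1)]; split;
    try (by exists a); try (by exists z1); move=> _ [z Xz <-];
    case: (hX z Xz) => [<-//|hz].
  - by apply: le_trans le _; apply: h1; exists z.
  - exact: ltW.
  - by apply: h1; exists z.
have [le|lt] := leP (F z2) (F a); [exists (F a)|exists (F z2)]; split;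
  try (by exists a); try (by exists z2); move=> _ [z Xz <-];
  case: (hX z Xz) => [<-//|hz].
- by apply: le_trans _ le; apply: h2; exists z.
- exact: ltW.
- by apply: h2; exists z.
Qed.

Lemma restr_moduli_extrema (n : nat) (M : 'M[R]_n) (W : {vspace 'cV[R]_n}) :
  invariant_subspace M W -> (0 < \dim W)%N ->
  (exists m, is_minimum (restr_moduli M W) m) /\
  (exists m, is_maximum (restr_moduli M W) m).
Proof.
move=> MW W0; have [rs hrs] := restr_eigenvalue_finite M W.
apply: (@finite_extrema _ _ _ rs).
  move=> z /hrs; elim: (rs) => //= a s IH.
  by rewrite inE => /predU1P [->|/IH]; [left|right].
exact: restr_eigenvalue_exists.
Qed.

(** If the modulus of [z'] were at most that of [z], a real or imaginary part of [v'] would grow no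
    faster than [v], up to a constant, against dominance with a small [e]. *)
Lemma modulus_lt_of_dominance (n : nat) (M : 'M[R]_n)
    (W W' : {vspace 'cV[R]_n}) (z z' : C) : M \in unitmx ->
  (forall (x x' : 'cV[R]_n) (e : R), x \in W -> x' \in W' -> x' != 0 -> 0 < e ->
     \forall k \near \oo, `|iter_mx M k *m x| <= e * `|iter_mx M k *m x'|) ->
  restr_eigenvalue M W z -> restr_eigenvalue M W' z' ->
  Normc.normc z < Normc.normc z'.
Proof.
move=> Mu dom [v [v0 vr vi hv]] [v' [v'0 v'r v'i hv']].
rewrite ltNge; apply/negP => le.
have z0 : z != 0.
  apply: contra v0 => /eqP z0; move: hv; rewrite z0 scale0r => hv.
  have toCu : toC M \in unitmx by rewrite map_unitmx.
  by rewrite -(mulKmx toCu v) hv mulmx0.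
have [x' [x'W x'0 x'le]] : exists x', [/\ x' \in W', x' != 0 &
    forall k, `|iter_mx M k *m x'| <= cnorm (z' ^+ k *: v')].
  have [h|h] := eqVneq (reM v') 0; [exists (imM v')|exists (reM v')]; split=> //.
  - by apply: contra v'0 => /eqP h'; rewrite (reim_eq0 h h').
  - by move=> k; rewrite -imM_mul (eigen_iter _ hv') /cnorm lerDr.
  - by move=> k; rewrite -reM_mul (eigen_iter _ hv') /cnorm lerDl.
have n0 := cnorm_gt0 v0; have n'0 := cnorm_gt0 v'0.
(* The 8 collects three factors 2: one from [cnormZ_ge], one from adding real and imaginary parts,
   one from [cnormZ_le]. *)
pose e := cnorm v / (8 * (cnorm v' + 1)).
have q0 : 0 < 8 * (cnorm v' + 1) by rewrite mulr_gt0 // ltr_wpDr // ltW.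
have e0 : 0 < e by rewrite divr_gt0.
have h1 := dom _ _ _ vr x'W x'0 e0; have h2 := dom _ _ _ vi x'W x'0 e0.
have [k [k1 k2]] := filter_ex (filterI h1 h2).
have zk : z ^+ k != 0 by exact: expf_neq0.
have a1 := cnormZ_ge v zk.
have a2 : cnorm (z ^+ k *: v) <= 2 * e * `|iter_mx M k *m x'|.
  by rewrite -(eigen_iter _ hv) /cnorm reM_mul imM_mul; lra.
have a3 := x'le k; have a4 := cnormZ_le (z' ^+ k) v'.
have a5 : Normc.normc (z' ^+ k) <= Normc.normc (z ^+ k).
  by rewrite !normcX; apply: lerXn2r; rewrite ?nnegrE ?normc_ge0.
have p0 : 0 < Normc.normc (z ^+ k).
  rewrite lt_neqAle normc_ge0 andbT eq_sym.
  by apply: contra zk => /eqP /Normc.eq0_normc ->.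
have a6 : `|iter_mx M k *m x'| <= 2 * Normc.normc (z ^+ k) * cnorm v'.
  apply: le_trans a3 _; apply: le_trans a4 _.
  by apply: ler_wpM2r; [exact: ltW|rewrite ler_pM2l].
have a7 : Normc.normc (z ^+ k) * cnorm v <=
    Normc.normc (z ^+ k) * (8 * e * cnorm v').
  apply: le_trans a1 _; have := ler_wpM2l (ltW e0) a6; lra.
move: a7; rewrite ler_pM2l // leNgt => /negP; apply.
have -> : 8 * e * cnorm v' = cnorm v * cnorm v' / (cnorm v' + 1).
  by rewrite /e; field; rewrite gt_eqF //; lra.
rewrite ltr_pdivrMr; last by lra.
by rewrite ltr_pM2l // ltrDl.
Qed.

End ComplexEigenvalues.

(** * The decomposition *)

Section SignChangeBlocks.
Variables (R : realType) (n : nat).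
Hypothesis n3 : (3 <= n)%N.

Definition block_dim (i : nat) : nat := if (i.+1 == nblocks n) && odd n then 1%N else 2%N.

(** Thus [nblocks n] is half of [n] rounded up, the number of odd values from 1 to [n]. *)
Lemma nblocksE : (nblocks n).*2 = (n + odd n)%N.
Proof.
rewrite /nblocks /ntilde; case: ifP => on; have := odd_double_half n; rewrite on; lia.
Qed.

Lemma sum_block_dim : (\sum_(i < nblocks n) block_dim i)%N = n.
Proof.
have := nblocksE; case E : (nblocks n) => [|m]; first by lia.
rewrite big_ord_recr /= (eq_bigr (fun=> 2%N)) => [|i _].
  by rewrite sum_nat_const card_ord /block_dim E eqxx /=; case: (odd n); lia.
by rewrite /block_dim E eqSS ltn_eqF.
Qed.

Lemma Nmax_half_lt (x : 'cV[R]_n) : ((Nmax x)./2 < nblocks n)%N.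
Proof.
have n0 : (0 < n)%N by lia.
have := odd_double_half (Nmax x); rewrite (odd_Nmax x n0).
have := Nmax_len x; have := nblocksE; lia.
Qed.

Lemma Nmin_half (x : 'cV[R]_n) : Nmin x = (Nmin x)./2.*2.+1.
Proof.
have n0 : (0 < n)%N by lia.
by have := odd_double_half (Nmin x); rewrite (odd_Nmin x n0); lia.
Qed.

Lemma Nmax_half (x : 'cV[R]_n) : Nmax x = (Nmax x)./2.*2.+1.
Proof.
have n0 : (0 < n)%N by lia.
by have := odd_double_half (Nmax x); rewrite (odd_Nmax x n0); lia.
Qed.

(* No nonzero vector of such a subspace has two consecutive zero coordinates,
   nor any zero coordinate in the top block for odd n, so reading off two (one)
   coordinates is injective on it. *)
Lemma dim_sign_block (F : {vspace 'cV[R]_n}) (i : nat) : (i < nblocks n)%N ->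
  (forall x, x \in F -> x != 0 -> (Nmin x)./2 = i /\ (Nmax x)./2 = i) ->
  (\dim F <= block_dim i)%N.
Proof.
move=> im hF; have n0 : (0 < n)%N by lia.
have FN x : x \in F -> x != 0 -> Ndomain x /\ Nmin x = i.*2.+1.
  move=> xF x0; have [h1 h2] := hF x xF x0.
  by rewrite /Ndomain /mkset Nmin_half Nmax_half h1 h2.
pose j0 := Ordinal n0; rewrite /block_dim; case: ifP => [/andP [/eqP iE on]|_].
  apply: (@dimv_le_separating _ _ _ _ (delta_mx 0 j0)) => x xF.
  rewrite mul_delta_mx_cv => /matrixP /(_ 0 0); rewrite !mxE !eqxx mulr1 => xj.
  apply/eqP; apply: contraT => x0; have [xN xE] := FN x xF x0.
  have xn : Nmin x = n by rewrite xE; have := nblocksE; rewrite on -iE; lia.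
  have n1 : (1 < n)%N by lia.
  by have := Ndomain_max_nonzero n1 xN xn j0; rewrite xj eqxx.
apply: (@dimv_le_separating _ _ 2 _
    (delta_mx 0 j0 + delta_mx ord_max (ordS j0))) => x xF.
rewrite mulmxDl !mul_delta_mx_cv => /matrixP h.
have := h 0 0; rewrite !mxE /= mulr1 mulr0 addr0 => x1.
have := h ord_max 0; rewrite !mxE /= mulr1 mulr0 add0r => x2.
apply/eqP; apply: contraT => x0; have [xN _] := FN x xF x0.
by case: (Ndomain_no_double_zero n3 xN x1 x2).
Qed.

End SignChangeBlocks.

(* The subspace W_i and the numbers mu_i, nu_i, for 1 <= i <= nblocks n, are
   indexed here by i - 1 : 'I_(nblocks n), so that 2i - 1 becomes i.*2.+1. *)
Theorem theorem3p1 (R : realType) (n : nat) (alpha beta : \bar R)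
    (A : R -> 'M[R]_n) (S : R -> R -> 'M[R]_n) :
  (3 <= n)%N ->
  (forall u, oitv alpha beta u -> {for u, continuous A}) ->
  (forall u, oitv alpha beta u -> Mminus (A u)) ->
  is_solution_operator alpha beta A S ->
  forall s t : R, oitv alpha beta s -> oitv alpha beta t -> s < t ->
  exists W : 'I_(nblocks n) -> {vspace 'cV[R]_n},
    (forall i, invariant_subspace (S s t) (W i)) /\
    (forall i, \dim (W i) = if (i.+1 == nblocks n) && odd n then 1%N else 2%N) /\
    ((\sum_i W i)%VS = fullv /\ directv (\sum_i W i)) /\
    (forall i x, x \in W i -> x != 0 ->
       Ndomain x /\ Next x = i.*2.+1) /\
    (forall (i k : 'I_(nblocks n)) x, (i <= k)%N ->
       x \in (\sum_(j < nblocks n | (i <= j <= k)%N) W j)%VS -> x != 0 ->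
       (i.*2.+1 <= Nmin x)%N /\ (Nmax x <= k.*2.+1)%N) /\
    exists nu mu : 'I_(nblocks n) -> R,
      (forall i, is_minimum (restr_moduli (S s t) (W i)) (nu i)) /\
      (forall i, is_maximum (restr_moduli (S s t) (W i)) (mu i)) /\
      (forall i, nu i <= mu i) /\
      (forall i j : 'I_(nblocks n), j = i.+1 :> nat -> mu j < nu i).
Proof.
move=> n3 Ac AM Ssol s t hs ht st.
pose m := nblocks n; pose M := S s t.
(* The operator from [t] back to [s] is a left inverse, as checked on basis vectors. *)
have Mu : M \in unitmx.
  suff h : S t s *m M = 1%:M by case: (mulmx1_unit h).
  apply/matrixP => i j.
  have := solution_operatorK Ac Ssol (delta_mx j 0) hs ht.
  rewrite mulmxA => /matrixP /(_ i 0).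
  rewrite -/M; move: (S t s *m M) => B.
  rewrite !mxE (bigD1 j) //= big1 => [|k kj]; last by rewrite mxE (negbTE kj) mulr0.
  by rewrite mxE !eqxx mulr1 addr0 andbT.
(* The counts are odd, so halving loses nothing and makes the values consecutive from 0. *)
have [||||||||W [WM Wdim [Wfull Wdir] WN Wdom]] := @invariant_splitting R n m
    (fun x => (Nmin x)./2) (fun x => (Nmax x)./2) M (block_dim n).
- by move=> x; apply: half_leq; exact: Nmin_leNmax.
- by move=> x; exact: Nmax_half_lt.
- move=> x; apply: filterS (Nminmax_near x) => y [h1 h2].
  by split; exact: half_leq.
- by move=> c x c0; have [-> ->] := NminmaxZ x c0.
- exact: Mu.
- by move=> x x0; apply: half_leq; exact: (Nmax_solution_operator n3 Ac AM Ssol).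
- by move=> F i; exact: dim_sign_block.
- exact: sum_block_dim.
have Winv (i : 'I_m) : invariant_subspace M (W i) by move=> x; exact: WM.
have Wpos (i : 'I_m) : (0 < \dim (W i))%N.
  by rewrite Wdim // /block_dim; case: ifP.
have sand (i k : 'I_m) x : (i <= k)%N ->
    x \in (\sum_(j < m | (i <= j <= k)%N) W j)%VS -> x != 0 ->
    (i.*2.+1 <= Nmin x)%N /\ (Nmax x <= k.*2.+1)%N.
  move=> ik xW x0; have ikm : (i <= k < m)%N by rewrite ik /=.
  have [h1 h2] := WN i k x ikm xW x0.
  by rewrite (Nmin_half n3) (Nmax_half n3) !ltnS !leq_double.
have ext i := restr_moduli_extrema (Winv i) (Wpos i).
have /choice [nu hnu] := fun i => (ext i).1.
have /choice [mu hmu] := fun i => (ext i).2.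
exists (fun i : 'I_m => W i); split; first exact: Winv.
split; first by move=> i; exact: Wdim.
split; first by [].
split.
  move=> i x xW x0.
  have [|h1 h2] := sand i i x (leqnn _) _ x0.
    by apply: (subvP (sumv_sup i _ (subvv _))); rewrite ?leqnn.
  have h3 := Nmin_leNmax x; split; apply/eqP; rewrite eqn_leq.
    by rewrite h3 (leq_trans h2 h1).
  by rewrite (leq_trans h3 h2) h1.
split; first by move=> i k x; exact: sand.
exists nu, mu; split; first exact: hnu.
split; first exact: hmu.
split; first by move=> i; apply: (hnu i).2; exact: (hmu i).1.
move=> i j ji; have [[z zW <-] _] := hmu j; have [[z' z'W <-] _] := hnu i.
apply: (modulus_lt_of_dominance Mu _ zW z'W) => x x' e.
have im : (i.+1 < m)%N by rewrite -ji.
by rewrite ji => xW x'W x'0 e0; exact: Wdom im xW x'W x'0 e0.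
Qed.
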